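(* Consider the hyperspherical latent partial causal model described in the context, with contrastive loss using $d(\mathbf{a},\mathbf{b})=-\mathbf{a}^T\mathbf{b}$ and temperature $\tau>0$. Suppose there is a bounded measurable map $\mathbf{h}:\mathbb{S}^{M-1}\to\mathbb{R}^M$ such that $\mathbf{f}_x(\mathbf{g}_x(\mathbf{z},\mathbf{m}))=\mathbf{h}(\mathbf{z})$ for all $\mathbf{z},\mathbf{m}$ and $\mathbf{f}_t(\mathbf{g}_t(\mathbf{z},\mathbf{m}'))=\mathbf{h}(\mathbf{z})$ for all $\mathbf{z},\mathbf{m}'$ (i.e. $\mathbf{f}_x\circ\mathbf{g}_x=\mathbf{f}_t\circ\mathbf{g}_t=\mathbf{h}$, independent of the modality-specific variables). Then, with $\mathcal{L}_N$ the multimodal contrastive loss on $N$ i.i.d. pairs $(\mathbf{x}_i,\mathbf{t}_i)$, $$\lim_{N\to\infty}\big(\mathcal{L}_N-2\log N\big)+2\log|\mathcal{Z}|=\mathbb{E}_{\mathbf{z}_x\sim p(\mathbf{z}_x)}\big[H(p(\mathbf{z}_t|\mathbf{z}_x),q_{\mathbf{h}}(\mathbf{z}_t|\mathbf{z}_x))\big]+\mathbb{E}_{\mathbf{z}_t\sim p(\mathbf{z}_t)}\big[H(p(\mathbf{z}_x|\mathbf{z}_t),q_{\mathbf{h}}(\mathbf{z}_x|\mathbf{z}_t))\big],$$ where $$q_{\mathbf{h}}(\mathbf{z}_x|\mathbf{z}_t)=C_q(\mathbf{z}_t)^{-1}e^{\mathbf{h}(\mathbf{z}_x)^T\mathbf{h}(\mathbf{z}_t)/\tau},\quad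 q_{\mathbf{h}}(\mathbf{z}_t|\mathbf{z}_x)=C_q(\mathbf{z}_x)^{-1}e^{\mathbf{h}(\mathbf{z}_t)^T\mathbf{h}(\mathbf{z}_x)/\tau},$$ $$C_q(\mathbf{z}_t)=\int_{\mathbb{S}^{M-1}}e^{\mathbf{h}(\mathbf{z}_x)^T\mathbf{h}(\mathbf{z}_t)/\tau}\,\mathrm{d}\mathbf{z}_x,\quad C_q(\mathbf{z}_x)=\int_{\mathbb{S}^{M-1}}e^{\mathbf{h}(\mathbf{z}_x)^T\mathbf{h}(\mathbf{z}_t)/\tau}\,\mathrm{d}\mathbf{z}_t.$$
   Context: Hyperspherical latent partial causal model: $\mathcal{Z}=\mathbb{S}^{M-1}$ is the unit sphere in $\mathbb{R}^M$ with surface measure $\mathrm{d}\mathbf{z}$ and total area $|\mathcal{Z}|$. The latent coupled variable $\mathbf{z}_x$ is uniform on $\mathcal{Z}$, $p(\mathbf{z}_x)=|\mathcal{Z}|^{-1}$, and conditionally $\mathbf{z}_t$ is von Mises–Fisher: $p(\mathbf{z}_t|\mathbf{z}_x)=C_p^{-1}e^{\kappa\mathbf{z}_t^T\mathbf{z}_x}$ with $\kappa>0$ and $C_p=\int_{\mathbb{S}^{M-1}}e^{\kappa\mathbf{z}_t^T\mathbf{z}_x}\mathrm{d}\mathbf{z}_t$ (independent of $\mathbf{z}_x$). Modality-specific latent variables $\mathbf{m}_x,\mathbf{m}_t$ are arbitrary random variables, with $\mathbf{m}_x$, $\mathbf{m}_t$, $(\mathbf{z}_x,\mathbf{z}_t)$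 mutually independent. Observations are $\mathbf{x}=\mathbf{g}_x(\mathbf{z}_x,\mathbf{m}_x)$ and $\mathbf{t}=\mathbf{g}_t(\mathbf{z}_t,\mathbf{m}_t)$ with $\mathbf{g}_x,\mathbf{g}_t$ injective (possibly nonlinear). $p(\mathbf{z}_t)$ denotes the marginal of $\mathbf{z}_t$ and $p(\mathbf{z}_x|\mathbf{z}_t)$ the conditional obtained by Bayes' rule. $H(p,q)=-\int p\log q$ is the cross-entropy. The multimodal contrastive loss on $N$ pairs with encoders $\mathbf{f}_x,\mathbf{f}_t$, function $d$ and temperature $\tau$ is $\mathcal{L}_N=-\frac1N\sum_{i}\log\frac{e^{-d(\mathbf{f}_x(\mathbf{x}_i),\mathbf{f}_t(\mathbf{t}_i))/\tau}}{\sum_{j}e^{-d(\mathbf{f}_x(\mathbf{x}_i),\mathbf{f}_t(\mathbf{t}_j))/\tau}}-\frac1N\sum_{i}\log\frac{e^{-d(\mathbf{f}_x(\mathbf{x}_i),\mathbf{f}_t(\mathbf{t}_i))/\tau}}{\sum_{j}e^{-d(\mathbf{f}_x(\mathbf{x}_j),\mathbf{f}_t(\mathbf{t}_i))/\tau}}$, sums over $1,\dots,N$. *)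

(* Defs.v *)
From HB Require Import structures.
From mathcomp Require Import all_boot all_order all_algebra.
From mathcomp Require Import all_classical all_reals all_analysis.
Set Implicit Arguments. Unset Strict Implicit. Unset Printing Implicit Defensive.
Import Order.TTheory GRing.Theory Num.Theory.
Import numFieldNormedType.Exports.
Local Open Scope classical_set_scope.
Local Open Scope ring_scope.

Section Defs.
Variables (R : realType) (M : nat).
Local Notation V := (M.-tuple R).

Definition dot (a b : V) : R := \sum_(i < M) tnth a i * tnth b i.
Definition sphere : set V := [set x | dot x x = 1].
Definition scale (r : R) (x : V) : V := map_tuple (fun c => r * c) x.
Definition box (a b : V) : set V :=
  [set x | forall i, tnth a i <= tnth x i < tnth b i].
Definition boxvol (a b : V) : R := \prod_(i < M) Num.max 0 (tnth b i - tnth a i).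
Definition lebesgue_outer (A : set V) : \bar R :=
  ereal_inf [set s | exists a b : nat -> V,
     A `<=` \bigcup_k box (a k) (b k) /\ s = (\sum_(k <oo) (boxvol (a k) (b k))%:E)%E].
Definition cone (A : set V) : set V :=
  [set y | exists r x, 0 < r <= 1 /\ (A `&` sphere) x /\ y = scale r x].
Definition surface (A : set V) : \bar R := (M%:R%:E * lebesgue_outer (cone A))%E.
Definition Sint (f : V -> R) : R := fine (\int[surface]_(x in sphere) (f x)%:E)%E.
End Defs.
Arguments sphere {R M}.

Section Prob.
Context {R : realType} {dO : measure_display} {Omega : measurableType dO}.
Variable P : probability Omega R.

Definition iid_seq {dT} {T : measurableType dT} (W : nat -> Omega -> T) : Prop :=
  [/\ (forall i, measurable_fun [set: Omega] (W i)),
      (forall i (A : set T), measurable A -> P (W i @^-1` A) = P (W 0%N @^-1` A)) &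
      (forall (s : seq nat) (A : nat -> set T), uniq s -> (forall i, measurable (A i)) ->
         P (\bigcap_(i in [set` s]) (W i @^-1` A i)) = (\prod_(i <- s) P (W i @^-1` A i))%E)].

Definition indep3 {d1 d2 d3} {T1 : measurableType d1} {T2 : measurableType d2}
  {T3 : measurableType d3} (Y1 : Omega -> T1) (Y2 : Omega -> T2) (Y3 : Omega -> T3) : Prop :=
  forall A1 A2 A3, measurable A1 -> measurable A2 -> measurable A3 ->
    P (Y1 @^-1` A1 `&` Y2 @^-1` A2 `&` Y3 @^-1` A3)
    = (P (Y1 @^-1` A1) * P (Y2 @^-1` A2) * P (Y3 @^-1` A3))%E.
End Prob.

Section Model.
Variables (R : realType) (M : nat).
Local Notation V := (M.-tuple R).
Local Notation Sint := (@Sint R M).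

Definition Zarea : R := fine (surface (@sphere R M)).
Definition p_x (zx : V) : R := Zarea^-1.
Definition Cp (kappa : R) (zx : V) : R := Sint (fun zt => expR (kappa * dot zt zx)).
Definition p_t_x (kappa : R) (zt zx : V) : R := expR (kappa * dot zt zx) / Cp kappa zx.
Definition p_t (kappa : R) (zt : V) : R := Sint (fun zx => p_x zx * p_t_x kappa zt zx).
Definition p_x_t (kappa : R) (zx zt : V) : R := p_x zx * p_t_x kappa zt zx / p_t kappa zt.

Definition Cq_t (tau : R) (h : V -> V) (zt : V) : R :=
  Sint (fun zx => expR (dot (h zx) (h zt) / tau)).
Definition Cq_x (tau : R) (h : V -> V) (zx : V) : R :=
  Sint (fun zt => expR (dot (h zx) (h zt) / tau)).
Definition q_x_t (tau : R) (h : V -> V) (zx zt : V) : R :=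
  expR (dot (h zx) (h zt) / tau) / Cq_t tau h zt.
Definition q_t_x (tau : R) (h : V -> V) (zt zx : V) : R :=
  expR (dot (h zt) (h zx) / tau) / Cq_x tau h zx.

Definition cross_entropy (p q : V -> R) : R := - Sint (fun z => p z * ln (q z)).

Definition rhs (kappa tau : R) (h : V -> V) : R :=
  Sint (fun zx => p_x zx * cross_entropy (p_t_x kappa ^~ zx) (q_t_x tau h ^~ zx))
  + Sint (fun zt => p_t kappa zt * cross_entropy (p_x_t kappa ^~ zt) (q_x_t tau h ^~ zt)).

Definition latent_model {dO dMx dMt} {Omega : measurableType dO}
  {Mx : measurableType dMx} {Mt : measurableType dMt}
  (P : probability Omega R) (kappa : R)
  (zx zt : nat -> Omega -> V) (mx : nat -> Omega -> Mx) (mt : nat -> Omega -> Mt) : Prop :=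
  [/\ iid_seq P (fun i w => (((zx i w, zt i w), mx i w), mt i w)),
      (forall i, indep3 P (fun w => (zx i w, zt i w)) (mx i) (mt i)) &
      (forall i (A B : set V), measurable A -> measurable B ->
         P (zx i @^-1` A `&` zt i @^-1` B) =
         (\int[surface (M:=M)]_(a in A `&` sphere)
            \int[surface (M:=M)]_(b in B `&` sphere) (p_x a * p_t_x kappa b a)%:E)%E)].

(** multimodal contrastive loss on the first N pairs, with encoded features u i = f_x(x_i),
    v i = f_t(t_i) *)
Definition contrastive_loss {F : Type} (d : F -> F -> R) (tau : R) (N : nat)
  (u v : nat -> F) : R :=
  let s i j := expR (- d (u i) (v j) / tau) in
  - N%:R^-1 * \sum_(i < N) ln (s i i / \sum_(j < N) s i j)
  - N%:R^-1 * \sum_(i < N) ln (s i i / \sum_(j < N) s j i).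
End Model.

(* Main.v *)
(** The surface measure is the (scaled) Lebesgue outer measure of cones over
    subsets of the sphere, hence a finite measure, and it is invariant under
    Householder reflections: the pushforward of Lebesgue measure by a
    reflection is translation invariant, so it is a multiple of Lebesgue
    measure, and the multiple is 1 since the ball is preserved.  A reflection
    exchanges any two points of the sphere, so the von Mises-Fisher constant
    does not depend on its centre.  Consequently both latent variables are
    uniform, their joint density is symmetric, and the two cross-entropy terms
    coincide.

    After subtracting 2 log N, the loss is an empirical mean of
    dot (h zx_i) (h zt_i) plus two averages over i of the logarithm of an
    average over j of exp (dot (h zx_i) (h zt_j) / tau).  The strong law
    handles the former; for the latter, the logarithm of the inner average is
    Lipschitz in h zx_i, uniformly in N, so its convergence on a finite grid
    is uniform, and the strong law applies again to the limit. *)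
Require Import Defs.
From HB Require Import structures.
From mathcomp Require Import all_boot all_order all_algebra.
From mathcomp Require Import all_classical all_reals all_analysis.
From mathcomp Require Import measurable_realfun ring lra zify.
Import Order.TTheory GRing.Theory Num.Theory.
Import numFieldNormedType.Exports.
Local Open Scope classical_set_scope.
Local Open Scope ring_scope.

(** * Lebesgue outer measure *)

(** [surface] is given as a bare set function, so the integration theorems apply only once it is
    known to be a measure: the Caratheodory criterion for half-spaces makes [lebesgue_outer]
    additive on measurable sets, and [surface] is a restriction of it followed by a pushforward. The
    volume of a box is not found by compactness. Covers bound it above by [boxvol]; the reverse
    bound comes from proportionality, tested on the ball when the ball is not null, and a null ball
    makes the invariance trivial. Nor is the area of the sphere computed: the total mass 1 of the
    model forces it to be positive.

    On the probabilistic side, the obstacle is that the inner average is evaluated at a random point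
    which changes with the outer index and is coupled with the inner sample, while a strong law
    concerns one function at a time and only countably many null sets may be discarded. Moving the
    random point to a grid point costs a factor close to 1, the same for every [N], and the grids of
    all meshes together are countable. *)

Lemma length_split {R : realDomainType} (a b c : R) : Num.max 0 (b - a) =
  Num.max 0 (Num.min b c - a) + Num.max 0 (b - Num.max a c).
Proof.
have [bc|cb] := leP b c; have [ac|ca] := leP a c.
- by rewrite [X in _ = _ + X]max_l ?addr0// subr_le0.
- by rewrite [X in _ = _ + X]max_l ?addr0// subr_le0 (le_trans bc)// ltW.
- rewrite !max_r ?subr_ge0 ?(ltW cb)//; last exact: le_trans ac (ltW cb).
  by rewrite [RHS]addrC addrA subrK.
- by rewrite [X in _ = X + _]max_l ?add0r// subr_le0 ltW.
Qed.

Section lebesgue_outer_cover.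
Context {R : realType} {M : nat}.
Local Notation V := (M.-tuple R).

Definition set_coord (b : V) (i : 'I_M) (c : R) : V :=
  [tuple if j == i then c else tnth b j | j < M].

Lemma tnth_set_coord b i c j :
  tnth (set_coord b i c) j = if j == i then c else tnth b j.
Proof. by rewrite tnth_mktuple. Qed.

Lemma boxvol_ge0 (a b : V) : 0 <= boxvol a b.
Proof. by apply: prodr_ge0 => i _; rewrite le_max lexx. Qed.

Lemma boxvol_split (a b : V) i c : boxvol a b =
  boxvol a (set_coord b i (Num.min (tnth b i) c)) +
  boxvol (set_coord a i (Num.max (tnth a i) c)) b.
Proof.
rewrite /boxvol (bigD1 i)//= [in RHS](bigD1 i)//= [X in _ = _ + X](bigD1 i)//=.
rewrite !tnth_set_coord eqxx.
set p := \prod_(j < M | j != i) _.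
rewrite (eq_bigr (fun j => Num.max 0 (tnth b j - tnth a j))); last first.
  by move=> j /negbTE ji; rewrite tnth_set_coord ji.
rewrite [X in _ = _ + _ * X](eq_bigr (fun j => Num.max 0 (tnth b j - tnth a j))); last first.
  by move=> j /negbTE ji; rewrite tnth_set_coord ji.
rewrite -mulrDl; congr (_ * _).
exact: length_split.
Qed.

Lemma box_setI_lt (a b : V) i c :
  box a b `&` [set x | tnth x i < c] `<=`
  box a (set_coord b i (Num.min (tnth b i) c)).
Proof.
move=> x [/= xab xc] j; rewrite tnth_set_coord; case: eqP => [->|_] //.
by have /andP[-> /= h] := xab i; rewrite lt_min h.
Qed.

Lemma box_setI_ge (a b : V) i c :
  box a b `&` ~` [set x | tnth x i < c] `<=`
  box (set_coord a i (Num.max (tnth a i) c)) b.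
Proof.
move=> x [/= xab /negP]; rewrite -leNgt => xc j.
rewrite tnth_set_coord; case: eqP => [->|_] //.
by have /andP[h ->] := xab i; rewrite ge_max h xc.
Qed.

Lemma lebesgue_outer_le_cover {A : set V} (a b : nat -> V) :
  A `<=` \bigcup_k box (a k) (b k) ->
  (lebesgue_outer A <= \sum_(k <oo) (boxvol (a k) (b k))%:E)%E.
Proof. by move=> Aab; apply: ereal_inf_lbound; exists a, b. Qed.

Lemma lebesgue_outer_ge0 (A : set V) : (0 <= lebesgue_outer A)%E.
Proof.
apply: le_ereal_inf_tmp => _ [a [b [_ ->]]].
by apply: nneseries_ge0 => k _ _; rewrite lee_fin boxvol_ge0.
Qed.

Lemma lebesgue_outer_sigma_subadditive (A : set V) (F : (set V)^nat) :
  subset_sigma_subadditive (@lebesgue_outer R M) A F.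
Proof.
(* Choosing a nearly optimal cover of [F i] needs a finite infimum, so an infinite term is treated
   apart. *)
move=> AF; have [[i ioo]|] := pselect (exists i, lebesgue_outer (F i) = +oo%E).
  rewrite (eseries_pinfty _ _ ioo) ?leey// => k _.
  by rewrite -ltNye (lt_le_trans _ (lebesgue_outer_ge0 _)).
rewrite -forallNE => Foo; apply/lee_addgt0Pr => e e0.
apply: (le_trans _ (epsilon_trick xpredT (fun n => lebesgue_outer_ge0 (F n)) (ltW e0))).
have [G GP] : {G : nat -> (nat -> V) * (nat -> V) & forall n,
    F n `<=` \bigcup_k box ((G n).1 k) ((G n).2 k) /\
    (\sum_(k <oo) (boxvol ((G n).1 k) ((G n).2 k))%:E <=
      lebesgue_outer (F n) + (e / (2 ^ n.+1)%:R)%:E)%E}.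
  apply: (@choice _ _ (fun n (g : (nat -> V) * (nat -> V)) =>
    F n `<=` \bigcup_k box (g.1 k) (g.2 k) /\
    (\sum_(k <oo) (boxvol (g.1 k) (g.2 k))%:E <=
      lebesgue_outer (F n) + (e / (2 ^ n.+1)%:R)%:E)%E)) => n.
  have en : 0 < e / (2 ^ n.+1)%:R by rewrite divr_gt0// ltr0n expn_gt0.
  have [] := lb_ereal_inf_adherent en (S := [set s | exists a b : nat -> V,
     F n `<=` \bigcup_k box (a k) (b k) /\
     s = (\sum_(k <oo) (boxvol (a k) (b k))%:E)%E]).
    rewrite -/(lebesgue_outer (F n)) ge0_fin_numE ?lebesgue_outer_ge0//.
    by rewrite ltey; apply/eqP.
  move=> _ [a [b [Fab ->]]] /ltW ab; by exists (a, b).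
(* The bijection [f] from [nat] to pairs merges the sequence of covers into a single cover. *)
have /card_esym/ppcard_eqP[f] := card_nat2.
have vol0 n k : (0 <= (boxvol ((G n).1 k) ((G n).2 k))%:E)%E.
  by rewrite lee_fin boxvol_ge0.
apply: (le_trans (lebesgue_outer_le_cover (fun m => (G (f m).1).1 (f m).2)
  (fun m => (G (f m).1).2 (f m).2) _)).
  move=> x /AF[n _ /(GP n).1[k _ xk]]; exists (f^-1%FUN (n, k)) => //=.
  by rewrite invK ?inE.
rewrite nneseries_esumT; last by move=> ?; exact: vol0.
rewrite -(reindex_esum [set: nat] [set: nat * nat] f
  (fun m => (boxvol ((G m.1).1 m.2) ((G m.1).2 m.2))%:E))//.
have -> : [set: nat * nat] = [set: nat] `*`` (fun=> [set: nat]).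
  by apply/seteqP; split.
rewrite -(esum_esum (a := fun n k => (boxvol ((G n).1 k) ((G n).2 k))%:E))//.
rewrite -nneseries_esumT; last by move=> n; apply: esum_ge0.
apply: lee_nneseries => [n _ _|n _]; first by apply: esum_ge0.
by rewrite -nneseries_esumT//; exact: (GP n).2.
Qed.

(** A hyperplane cuts every box of a cover of [X] into two boxes whose volumes add up, and the
    pieces on either side cover the two parts of [X]. *)
Lemma lebesgue_outer_caratheodory_lt (i : 'I_M) (c : R) (X : set V) :
  (lebesgue_outer (X `&` [set x | (tnth x i < c)%R]) +
   lebesgue_outer (X `&` ~` [set x | (tnth x i < c)%R]) <= lebesgue_outer X)%E.
Proof.
apply: le_ereal_inf_tmp => _ [a [b [Xab ->]]].
under eq_eseriesr => k _ do rewrite (boxvol_split _ _ i c) EFinD.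
rewrite nneseriesD; try by move=> *; rewrite lee_fin boxvol_ge0.
apply: leeD; apply: lebesgue_outer_le_cover.
  by move=> x [/Xab[k _ xk] xc]; exists k => //; exact: box_setI_lt.
by move=> x [/Xab[k _ xk] xc]; exists k => //; exact: box_setI_ge.
Qed.

Definition translate (z x : V) : V := [tuple tnth x i + tnth z i | i < M].

Lemma tnth_translate z x i : tnth (translate z x) i = tnth x i + tnth z i.
Proof. by rewrite tnth_mktuple. Qed.

Definition opp_tuple (x : V) : V := [tuple - tnth x i | i < M].

Lemma translateNK z : cancel (translate (opp_tuple z)) (translate z).
Proof.
by move=> x; apply: eq_from_tnth => i; rewrite !tnth_translate tnth_mktuple subrK.
Qed.

Lemma le_lebesgue_outer_translate z (A : set V) :
  (lebesgue_outer (translate z @^-1` A) <= lebesgue_outer A)%E.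
Proof.
apply: le_ereal_inf_tmp => _ [a [b [Aab ->]]].
rewrite (_ : (\sum_(k <oo) (boxvol (a k) (b k))%:E)%E =
  (\sum_(k <oo) (boxvol (translate (opp_tuple z) (a k))
    (translate (opp_tuple z) (b k)))%:E)%E).
  apply: lebesgue_outer_le_cover => x /Aab[k _ xk]; exists k => // i.
  have := xk i; rewrite !tnth_translate tnth_mktuple => /andP[xa xb].
  by apply/andP; split; lra.
apply: eq_eseriesr => k _; congr EFin; apply: eq_bigr => i _.
by rewrite !tnth_translate; congr (Num.max _ _); ring.
Qed.

Lemma lebesgue_outer_translate z (A : set V) :
  lebesgue_outer (translate z @^-1` A) = lebesgue_outer A.
Proof.
apply/eqP; rewrite eq_le le_lebesgue_outer_translate/=.
have := le_lebesgue_outer_translate (opp_tuple z) (translate z @^-1` A).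
by rewrite -comp_preimage (_ : _ \o _ = id)// funeqE; exact: translateNK.
Qed.

End lebesgue_outer_cover.

Section lebesgue_outer_measure.
Context {R : realType} {n : nat}.
Local Notation V := (n.+1.-tuple R).
Local Notation leb := (@lebesgue_outer R n.+1).

Lemma le_lebesgue_outer_box (a b : V) : (leb (box a b) <= (boxvol a b)%:E)%E.
Proof.
apply: (le_trans (lebesgue_outer_le_cover (fun k => a)
  (fun k => if k is 0%N then b else a) _)).
  by move=> x xab; exists 0%N.
rewrite nneseries_recl//; last by move=> *; rewrite lee_fin boxvol_ge0.
rewrite eseries_cond/= eseries0 ?adde0// => -[|k]//= _ _.
by rewrite /boxvol big_ord_recl subrr maxxx mul0r.
Qed.

(** Positive dimension matters: an empty product would give every box volume 1 and, covers being
    infinite sequences, even the empty set would have outer measure [+oo]. *)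
Lemma lebesgue_outer_set0 : leb set0 = 0%E.
Proof.
apply/eqP; rewrite eq_le lebesgue_outer_ge0 andbT.
pose o : V := [tuple 0 | i < n.+1].
apply: (le_trans (lebesgue_outer_le_cover (fun=> o) (fun=> o) _)) => //.
rewrite eseries0// => k _ _.
by rewrite /boxvol big_ord_recl subrr maxxx mul0r.
Qed.

HB.instance Definition _ := @isSubsetOuterMeasure.Build R V leb
  lebesgue_outer_set0 lebesgue_outer_ge0 lebesgue_outer_sigma_subadditive.

(** Measurable sets of tuples are generated by the coordinates, and those of [R] by the rays []-oo,
    c[], so half-spaces suffice. *)
Lemma measurable_caratheodory (A : set V) : measurable A ->
  leb.-cara.-measurable A.
Proof.
suff mtnth (i : 'I_n.+1) :
    measurable_fun [set: caratheodory_type leb] (fun x => tnth (x : V) i).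
  apply: smallest_sub; first exact: sigma_algebra_measurable.
  rewrite -bigcup_mkord_ord; apply: bigcup_sub => i _ _ [B mB <-].
  exact: mtnth.
apply: (measurability _ (RGenInftyO.measurableE R)).
move=> _ [_ [c ->] <-]; rewrite setTI.
apply: le_caratheodory_measurable => X.
suff -> : (fun x : V => tnth x i) @^-1` `]-oo, c[ = [set x | tnth x i < c].
  exact: lebesgue_outer_caratheodory_lt.
by apply/seteqP; split => x /=; rewrite in_itv.
Qed.

Lemma lebesgue_outer_sigma_additive :
  semi_sigma_additive (leb : set V -> \bar R).
Proof.
move=> F mF tF mUF.
have cF i : leb.-cara.-measurable (F i) by exact: measurable_caratheodory.
apply: (caratheodory_measure_sigma_additive (mu := leb)) => //.
exact: measurable_caratheodory.
Qed.

HB.instance Definition _ := isMeasure.Build _ V R leb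
  lebesgue_outer_set0 lebesgue_outer_ge0 lebesgue_outer_sigma_additive.

End lebesgue_outer_measure.

(** * Translation-invariant measures *)

(** Cauchy's equation on the half-line: nonnegativity makes [f] monotone, which replaces continuity
    and lets [n * t] be squeezed between consecutive integers. *)
Lemma additive_ge0_linear {R : realType} (f : R -> R) :
  (forall t, 0 <= t -> 0 <= f t) ->
  (forall s t, 0 <= s -> 0 <= t -> f (s + t) = f s + f t) ->
  forall t, 0 <= t -> f t = t * f 1.
Proof.
move=> f0 fD t t0.
have fM k s : 0 <= s -> f (k.+1%:R * s) = k.+1%:R * f s.
  move=> s0; elim: k => [|k IH]; first by rewrite !mul1r.
  by rewrite -[k.+2]addn1 natrD !mulrDl !mul1r fD// ?IH// mulr_ge0.
have f00 : f 0 = 0.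
  have := fD 0 0 (lexx _) (lexx _); rewrite addr0 => /eqP.
  by rewrite -subr_eq0 opprD addNKr oppr_eq0 => /eqP.
have fN k : f k%:R = k%:R * f 1.
  by case: k => [|k]; [rewrite f00 mul0r|rewrite -[k.+1%:R in LHS]mulr1 fM].
have fmono s u : 0 <= s -> s <= u -> f s <= f u.
  move=> s0 su; rewrite -(subrK s u) addrC fD ?subr_ge0//.
  by rewrite lerDl f0// subr_ge0.
apply/eqP; rewrite -subr_eq0 -normr_le0; apply/ler_addgt0Pl => e e0.
rewrite addr0 -[leRHS]mul1r.
(* The squeeze between [k / n] and [(k + 1) / n] leaves an error [f 1 / n], less than [e] for this
   [n]. *)
pose n := (Num.truncn (f 1 / e)).+1.
have n0 : 0 < n%:R :> R by rewrite ltr0n.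
have fn : f 1 < n%:R * e.
  by rewrite -ltr_pdivrMr// truncnS_gt.
pose k := Num.truncn (n%:R * t).
have nt0 : 0 <= n%:R * t by rewrite mulr_ge0.
have /andP[kl ku] : k%:R <= n%:R * t < k.+1%:R.
  by apply/andP; split; [rewrite truncn_le|exact: truncnS_gt].
have h1 : k%:R * f 1 <= n%:R * f t by rewrite -fN -fM// fmono.
have h2 : n%:R * f t <= k.+1%:R * f 1 by rewrite -fN -fM// fmono// ltW.
have f1 := f0 1 ler01.
have h3 : n%:R * t * f 1 <= k.+1%:R * f 1 by rewrite ler_wpM2r// ltW.
have h4 : k%:R * f 1 <= n%:R * t * f 1 by rewrite ler_wpM2r.
rewrite -(ler_pM2l n0) mul1r -[n%:R in leLHS]ger0_norm// -normrM ler_norml mulrBr.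
rewrite -natr1 mulrDl mul1r in h2 h3.
by apply/andP; split; lra.
Qed.

Lemma measurable_box {R : realType} {M : nat} (a b : M.-tuple R) :
  measurable (box a b).
Proof.
have -> : box a b =
    \bigcap_(i in [set: 'I_M]) ((@tnth M R ^~ i) @^-1` `[tnth a i, tnth b i[).
  by apply/seteqP; split => x xab i; have := xab i; rewrite /= in_itv//= => h; exact: h.
apply: fin_bigcap_measurable => // i _.
by rewrite -[X in measurable X]setTI; exact: measurable_tnth.
Qed.

Section translation_invariant.
Context {R : realType} {n : nat}.
Local Notation V := (n.+1.-tuple R).
Variable nu : {measure set V -> \bar R}.
Hypothesis nu_translate : forall z a b,
  nu (translate z @^-1` box a b) = nu (box a b).
Hypothesis nu_box_lty : forall a b, (nu (box a b) < +oo)%E.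

Let o : V := [tuple 0 | i < n.+1].
Let e : V := [tuple 1 | i < n.+1].
Let F (l : V) := fine (nu (box o l)).

(** The box is cut at height [s] in direction [i]; the upper part is a translate of the box of
    height [t]. *)
Let F_additive l i s t : 0 <= s -> 0 <= t ->
  F (set_coord l i (s + t)) = F (set_coord l i s) + F (set_coord l i t).
Proof.
move=> s0 t0; rewrite /F.
have -> : box o (set_coord l i (s + t)) = box o (set_coord l i s) `|`
    box (set_coord o i s) (set_coord l i (s + t)).
  apply/seteqP; split => x /=.
    move=> h; have [xs|sx] := ltP (tnth x i) s.
      left => j; have := h j; rewrite !tnth_set_coord tnth_mktuple.
      by case: eqP => // -> /andP[->].
    right => j; have := h j; rewrite !tnth_set_coord tnth_mktuple.
    by case: eqP => // -> /andP[_ ->]; rewrite sx.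
  case=> h j; have := h j; rewrite !tnth_set_coord tnth_mktuple.
    by case: eqP => // -> /andP[-> /= h']; rewrite (lt_le_trans h')// lerDl.
  by case: eqP => // -> /andP[h' ->]; rewrite (le_trans s0 h').
rewrite measureU//; [|exact: measurable_box|exact: measurable_box|].
  rewrite fineD ?ge0_fin_numE ?nu_box_lty//; congr (_ + _); congr fine.
  apply: (etrans (esym (nu_translate (set_coord o i s) _ _))); congr (nu _).
  apply/seteqP; split => x /= h j; have := h j;
    rewrite !tnth_translate !tnth_set_coord !tnth_mktuple;
    case: eqP => [_|_]; rewrite ?addr0//; lra.
apply/seteqP; split => // x /= [] /(_ i) + /(_ i).
rewrite !tnth_set_coord eqxx tnth_mktuple => /andP[_ h1] /andP[h2 _].
by move: (lt_le_trans h1 h2); rewrite ltxx.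
Qed.

(* Cauchy's functional equation in one coordinate, the others being fixed. *)
Let F_homogeneous l i t : 0 <= t ->
  F (set_coord l i t) = t * F (set_coord l i 1).
Proof.
apply: (@additive_ge0_linear R (fun t => F (set_coord l i t))) => *.
  by rewrite fine_ge0.
exact: F_additive.
Qed.

Let F_prod (l : V) : (forall i, 0 <= tnth l i) -> F l = \prod_i tnth l i * F e.
Proof.
move=> l0.
(* The coordinates in [s] have already been pulled out as factors and replaced by 1. *)
have H (s : seq 'I_n.+1) : uniq s -> F l = \prod_(i <- s) tnth l i *
    F [tuple if i \in s then 1 else tnth l i | i < n.+1].
  elim: s => [_|i s IH /= /andP[si us]].
    rewrite big_nil mul1r; congr F.
    by apply: eq_from_tnth => i; rewrite tnth_mktuple.
  rewrite IH// big_cons; set m := mktuple _.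
  have -> : m = set_coord m i (tnth l i).
    apply: eq_from_tnth => j; rewrite tnth_set_coord.
    by case: eqP => // ->; rewrite tnth_mktuple (negbTE si).
  rewrite F_homogeneous// mulrCA mulrA; congr (_ * F _).
  apply: eq_from_tnth => j; rewrite tnth_set_coord !tnth_mktuple in_cons.
  by case: eqP.
rewrite (H (index_enum 'I_n.+1)) ?index_enum_uniq//; congr (_ * F _).
by apply: eq_from_tnth => j; rewrite !tnth_mktuple mem_index_enum.
Qed.

Lemma translation_invariant_box a b :
  nu (box a b) = (fine (nu (box o e)) * boxvol a b)%:E.
Proof.
have [ab|] := pselect (forall i, tnth a i <= tnth b i); last first.
  move=> /existsNP[i /negP]; rewrite -ltNge => ba.
  have -> : box a b = set0.
    apply/seteqP; split => // x /(_ i) /andP[ax xb].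
    by have := lt_trans (le_lt_trans ax xb) ba; rewrite ltxx.
  rewrite measure0 /boxvol (bigD1 i)//= max_l ?mul0r ?mulr0//.
  by rewrite subr_le0 ltW.
have -> : box a b = translate (opp_tuple a) @^-1` box o (translate (opp_tuple a) b).
  apply/seteqP; split => x /= h i; have := h i; rewrite !tnth_translate !tnth_mktuple.
    by lra.
  by lra.
rewrite nu_translate -[LHS]fineK ?ge0_fin_numE ?nu_box_lty//; congr EFin.
rewrite -/(F (translate (opp_tuple a) b)) F_prod => [|i]; last first.
  by rewrite tnth_translate tnth_mktuple subr_ge0.
rewrite mulrC; congr (_ * _); apply: eq_bigr => i _.
by rewrite !tnth_mktuple max_r// subr_ge0.
Qed.

(** Subadditivity of [nu] over a cover by boxes, on each of which [nu] is [c] times the volume,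
    followed by the infimum over covers. *)
Lemma translation_invariant_le (A : set V) : measurable A ->
  (nu A <= (fine (nu (box o e)))%:E * lebesgue_outer A)%E.
Proof.
move=> mA; set c := fine _.
have c0 : 0 <= c by rewrite fine_ge0.
have le_cover (a b : nat -> V) : A `<=` \bigcup_k box (a k) (b k) ->
    (nu A <= c%:E * \sum_(k <oo) (boxvol (a k) (b k))%:E)%E.
  move=> Aab; rewrite -nneseriesZl//.
    under eq_eseriesr => k _ do rewrite -EFinM -translation_invariant_box.
    apply: measure_sigma_subadditive => //= k; exact: measurable_box.
  by move=> k _; rewrite lee_fin boxvol_ge0.
(* Passing to the infimum divides by [c]. If [c = 0], one cover by cubes exhausting the space
   already gives [nu A <= 0]. *)
have [c00|c_gt0] := leP c 0.
  have {c00}c0' : c = 0 by apply/le_anti; rewrite c00.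
  rewrite c0' mul0e.
  have := le_cover (fun k => [tuple - k%:R | i < n.+1]) (fun k => [tuple k%:R | i < n.+1]).
  rewrite c0' mul0e; apply => x _.
  exists (Num.truncn (\sum_i `|tnth x i|)).+1 => // i; rewrite !tnth_mktuple.
  have : `|tnth x i| < (Num.truncn (\sum_i `|tnth x i|)).+1%:R.
    apply: le_lt_trans (truncnS_gt _).
    by rewrite (bigD1 i)//= lerDl sumr_ge0.
  by rewrite ltr_norml => /andP[/ltW -> ->].
rewrite -lee_pdivrMl//; apply: le_ereal_inf_tmp => _ [a [b [Aab ->]]].
by rewrite lee_pdivrMl// le_cover.
Qed.

End translation_invariant.

(** * Reflections *)

Definition pushforward_measure {d1 d2} {T1 : measurableType d1}
  {T2 : measurableType d2} {R : realType} (m : {measure set T1 -> \bar R})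
  (f : T1 -> T2) (mf : measurable_fun [set: T1] f) :
  {measure set T2 -> \bar R}.
Proof. by refine (pushforward m f : {measure set T2 -> \bar R}). Defined.

Section dot_product.
Context {R : realType} {M : nat}.
Local Notation V := (M.-tuple R).
Implicit Types x y z v : V.

Lemma dotC x y : dot x y = dot y x.
Proof. by apply: eq_bigr => i _; rewrite mulrC. Qed.

Lemma dot_ge0 x : 0 <= dot x x.
Proof. by apply: sumr_ge0 => i _; rewrite -expr2 sqr_ge0. Qed.

Lemma sqr_coord_le_dot x i : tnth x i ^+ 2 <= dot x x.
Proof.
rewrite /dot (bigD1 i)//= -expr2 lerDl.
by apply: sumr_ge0 => j _; rewrite -expr2 sqr_ge0.
Qed.

Lemma measurable_dot : measurable_fun [set: V * V] (fun p => dot p.1 p.2).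
Proof.
apply: measurable_sum => i; apply: measurable_funM.
  exact: measurableT_comp (measurable_tnth i) measurable_fst.
exact: measurableT_comp (measurable_tnth i) measurable_snd.
Qed.

Lemma measurable_dot_diag : measurable_fun [set: V] (fun x => dot x x).
Proof.
exact: measurableT_comp measurable_dot (measurable_fun_pair _ _).
Qed.

Lemma measurable_sphere : measurable (@sphere R M).
Proof.
have -> : @sphere R M = (fun x => dot x x) @^-1` [set 1] by [].
by rewrite -[X in measurable X]setTI; exact: measurable_dot_diag.
Qed.

Lemma dot_scale r x : dot (scale r x) (scale r x) = r ^+ 2 * dot x x.
Proof.
rewrite /dot mulr_sumr; apply: eq_bigr => i _.
by rewrite !tnth_map; ring.
Qed.

Lemma measurable_scale (f : V -> R) : measurable_fun setT f ->
  measurable_fun [set: V] (fun x => scale (f x) x).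
Proof.
move=> mf; apply/measurable_fun_tnthP => i.
rewrite (_ : _ \o _ = (fun x => f x * tnth x i)).
  by apply: measurable_funM => //; exact: measurable_tnth.
by apply/funext => x /=; rewrite tnth_map.
Qed.

(* For [v] of norm 0 the quotient is 0, so that the reflection is the identity. *)
Definition reflection v x : V :=
  [tuple tnth x i - 2 * dot v x / dot v v * tnth v i | i < M].

Lemma dot_reflection v x y : dot (reflection v x) (reflection v y) = dot x y.
Proof.
have [vv0|vv0] := eqVneq (dot v v) 0.
  rewrite /dot; apply: eq_bigr => i _; rewrite !tnth_mktuple vv0 invr0.
  by rewrite !mulr0 !mul0r !subr0.
set c := fun z => 2 * dot v z / dot v v.
suff -> : dot (reflection v x) (reflection v y) =
    dot x y - c x * dot v y - c y * dot v x + c x * c y * dot v v.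
  by rewrite /c; field.
rewrite (dotC v x) /dot !mulr_sumr -!sumrB -big_split/=.
by apply: eq_bigr => i _; rewrite !tnth_mktuple -/(c x) -/(c y); ring.
Qed.

Lemma dot_reflection_normal v x : dot v (reflection v x) = - dot v x.
Proof.
have [vv0|vv0] := eqVneq (dot v v) 0.
  have v0 i : tnth v i = 0.
    apply/eqP; rewrite -sqrf_eq0; apply/eqP/le_anti.
    by rewrite sqr_ge0 andbT -vv0 sqr_coord_le_dot.
  rewrite /dot !big1 ?oppr0// => i _; by rewrite v0 mul0r.
transitivity (dot v x - 2 * dot v x / dot v v * dot v v); last by field.
rewrite {1 2 5}/dot mulr_sumr -sumrB.
by apply: eq_bigr => i _; rewrite !tnth_mktuple; ring.
Qed.

Lemma reflectionK v : involutive (reflection v).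
Proof.
move=> x; apply: eq_from_tnth => i.
rewrite tnth_mktuple dot_reflection_normal tnth_mktuple.
ring.
Qed.

Lemma dotB x y z : dot (translate (opp_tuple y) x) z = dot x z - dot y z.
Proof.
rewrite /dot -sumrB; apply: eq_bigr => i _.
by rewrite !tnth_mktuple; ring.
Qed.

Lemma dotD x y z : dot z (translate y x) = dot z x + dot z y.
Proof.
rewrite /dot -big_split; apply: eq_bigr => i _.
by rewrite tnth_translate /=; ring.
Qed.

Lemma reflection_translate v z x :
  reflection v (translate z x) = translate (reflection v z) (reflection v x).
Proof.
apply: eq_from_tnth => i; rewrite tnth_translate !tnth_mktuple dotD.
ring.
Qed.

(** With [v = x - y] and equal norms, [dot v v = 2 * dot v x]; the coefficient of [v] is then 1 and
    the image is [x - v = y]. If [v] has norm 0, then [x = y]. *)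
Lemma reflection_swap x y : dot x x = dot y y ->
  reflection (translate (opp_tuple y) x) x = y.
Proof.
move=> xy; set v := translate _ _.
have vv : dot v v = 2 * dot v x.
  have vz z : dot v z = dot x z - dot y z by exact: dotB.
  by rewrite vz (dotC x v) (dotC y v) !vz (dotC y x) -xy; ring.
have tv i : tnth v i = tnth x i - tnth y i by rewrite tnth_translate tnth_mktuple.
have [vv0|vv0] := eqVneq (dot v v) 0.
  apply: eq_from_tnth => i; rewrite tnth_mktuple vv0 invr0 mulr0 mul0r subr0.
  apply/eqP; rewrite -subr_eq0 -tv -sqrf_eq0; apply/eqP/le_anti.
  by rewrite sqr_ge0 andbT -vv0 sqr_coord_le_dot.
apply: eq_from_tnth => i; rewrite tnth_mktuple -vv divff// mul1r tv.
by rewrite opprB addrC subrK.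
Qed.

Lemma measurable_reflection v : measurable_fun setT (reflection v).
Proof.
apply/measurable_fun_tnthP => i.
rewrite (_ : _ \o _ = (fun x => tnth x i - 2 * dot v x / dot v v * tnth v i)).
  apply: measurable_funB; first exact: measurable_tnth.
  do 2 apply: measurable_funM => //; apply: measurable_funM => //.
  exact: measurableT_comp measurable_dot (measurable_fun_pair _ _).
by apply/funext => x /=; rewrite tnth_mktuple.
Qed.

End dot_product.

Section lebesgue_reflection.
Context {R : realType} {n : nat}.
Local Notation V := (n.+1.-tuple R).
Local Notation leb := (@lebesgue_outer R n.+1).

(** This is the cone over the whole sphere; the origin is missing because [cone] takes radii
    [r > 0]. *)
Definition punctured_ball : set V := [set y | 0 < dot y y <= 1].

Lemma measurable_punctured_ball : measurable punctured_ball.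
Proof.
have -> : punctured_ball = (fun x => dot x x) @^-1` `]0, 1].
  by apply/seteqP; split => x; rewrite /= in_itv.
by rewrite -[X in measurable X]setTI; exact: measurable_dot_diag.
Qed.

Let o : V := [tuple 0 | i < n.+1].
Let e : V := [tuple 1 | i < n.+1].
(** Boxes are half-open, so [[-1, 1[] in each coordinate would miss points of the ball; 2 leaves
    room. *)
Let Q : set V := box [tuple - 2 | i < n.+1] [tuple 2 | i < n.+1].

Lemma punctured_ball_box : punctured_ball `<=` Q.
Proof.
move=> y /= /andP[_ y1] i; rewrite !tnth_mktuple.
have := le_trans (sqr_coord_le_dot y i) y1 => h.
by apply/andP; split; nra.
Qed.

Lemma lebesgue_outer_box_lty (a b : V) : (leb (box a b) < +oo)%E.
Proof. by apply: le_lt_trans (le_lebesgue_outer_box a b) _; rewrite ltry. Qed.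

Variable v : V.
Let T := reflection v.
Let nu := pushforward_measure leb T (measurable_reflection v).

Let nuE A : nu A = leb (T @^-1` A). Proof. by []. Qed.

Let nu_translate z a b : nu (translate z @^-1` box a b) = nu (box a b).
Proof.
rewrite !nuE -[RHS](lebesgue_outer_translate (T z)); congr leb.
apply/seteqP; split => x; rewrite /preimage/= /T reflection_translate.
  by rewrite reflectionK.
by rewrite reflectionK.
Qed.

Let nu_box_lty a b : (nu (box a b) < +oo)%E.
Proof.
(* [K - 1] bounds the squared norm on [box a b], hence on its preimage, since reflections preserve
   norms. The extra 1 lets [t ^+ 2 <= K - 1] imply [- K <= t < K]. *)
rewrite nuE; pose K := \sum_i (`|tnth a i| + `|tnth b i|) ^+ 2 + 1.
apply: le_lt_trans (lebesgue_outer_box_lty [tuple - K | i < n.+1] [tuple K | i < n.+1]).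
apply: le_outer_measure => x /= xab i; rewrite !tnth_mktuple.
have : dot x x <= K - 1.
  rewrite -(dot_reflection v) addrK; apply: ler_sum => j _.
  have := xab j; rewrite -/T; move: (tnth (T x) j) => t /andP[ta tb].
  have := ler_normr (tnth a j) (- tnth a j) ; have := ler_norm (tnth b j).
  have := ler_norm (- tnth a j); rewrite normrN.
  have := normr_ge0 (tnth a j); have := normr_ge0 (tnth b j).
  move: `|tnth a j| `|tnth b j| => p q q0 p0 ap bq _.
  by nra.
move=> h; have := le_trans (sqr_coord_le_dot x i) h => h'.
by apply/andP; split; nra.
Qed.

(* Both [leb] and its image [nu] are proportional to the volume on boxes and
   bounded accordingly on all sets. Comparing them on the reflection-invariant
   punctured ball and on its complement in the box [Q] gives the constant 1. *)
Lemma le_lebesgue_outer_reflection (C : set V) :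
  (leb punctured_ball != 0)%E -> measurable C ->
  (leb (T @^-1` C) <= leb C)%E.
Proof.
move=> D0 mC; set D := punctured_ball in D0.
have mD : measurable D by exact: measurable_punctured_ball.
have mQ : measurable Q by exact: measurable_box.
have mQD : measurable (Q `\` D) by exact: measurableD.
have Qfin : (leb Q < +oo)%E by exact: lebesgue_outer_box_lty.
have Dfin : (leb D < +oo)%E.
  apply: le_lt_trans Qfin; apply: le_outer_measure; exact: punctured_ball_box.
have nuD : nu D = leb D.
  rewrite nuE; congr leb; apply/seteqP; split => x;
  by rewrite /D /punctured_ball /= dot_reflection.
pose c := fine (nu (box o e)); pose c0 := fine (leb (box o e)).
have nu_le A : measurable A -> (nu A <= c%:E * leb A)%E.
  exact: translation_invariant_le.
have leb_le A : measurable A -> (leb A <= c0%:E * leb A)%E.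
  apply: translation_invariant_le; last exact: lebesgue_outer_box_lty.
  by move=> *; exact: lebesgue_outer_translate.
have lebD_gt0 : 0 < fine (leb D).
  by rewrite fine_gt0// Dfin andbT lt0e D0 measure_ge0.
have lebDE : leb D = (fine (leb D))%:E by rewrite fineK// ge0_fin_numE.
have c0_ge1 : 1 <= c0.
  have := leb_le _ mD; rewrite lebDE -EFinM lee_fin -ler_pdivrMr// divff//.
  by rewrite gt_eqF.
have volQ : 0 < boxvol [tuple - 2 | i < n.+1] [tuple 2 | i < n.+1] :> R.
  by apply: prodr_gt0 => i _; rewrite !tnth_mktuple lt_max; apply/orP; right; lra.
have lebQ : leb Q = (c0 * boxvol [tuple - 2 | i < n.+1] [tuple 2 | i < n.+1])%:E.
  apply: translation_invariant_box; last exact: lebesgue_outer_box_lty.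
  by move=> *; exact: lebesgue_outer_translate.
have nuQ : nu Q = (c * boxvol [tuple - 2 | i < n.+1] [tuple 2 | i < n.+1])%:E.
  exact: translation_invariant_box.
(* The lower bound came from testing on the ball, of positive finite measure; the upper one holds
   because a box covers itself. Thus [leb Q] is the volume of [Q]. *)
have c0E : c0 = 1.
  apply/le_anti; rewrite c0_ge1 andbT.
  have := le_lebesgue_outer_box [tuple - 2 | i < n.+1] [tuple 2 | i < n.+1] : (leb Q <= _)%E.
  by rewrite lebQ lee_fin -{2}[boxvol _ _]mul1r ler_pM2r.
rewrite c0E mul1r in lebQ.
have c_ge1 : 1 <= c.
  have := nu_le _ mD; rewrite nuD lebDE -EFinM lee_fin -ler_pdivrMr// divff//.
  by rewrite gt_eqF.
suff c1 : c = 1 by have := nu_le C mC; rewrite c1 mul1e nuE.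
have splitQ : Q = D `|` (Q `\` D).
  by rewrite setDUK//; exact: punctured_ball_box.
(* The factor [c] is spared on [D]. Since [nu Q = c * leb Q], cancelling the part outside [D] leaves
   [c * leb D <= leb D]. *)
have leQ : (nu Q <= leb D + c%:E * leb (Q `\` D))%E.
  have -> : nu Q = (nu D + nu (Q `\` D))%E.
    by rewrite {1}splitQ; apply: measureU => //; rewrite setDE setICA setICr setI0.
  by rewrite nuD leeD2l// nu_le.
have lebQE : (leb Q = leb D + leb (Q `\` D))%E.
  by rewrite {1}splitQ; apply: measureU => //; rewrite setDE setICA setICr setI0.
have QDfin : (leb (Q `\` D) < +oo)%E.
  by apply: le_lt_trans Qfin; apply: le_outer_measure; exact: subDsetl.
have QDE : leb (Q `\` D) = (fine (leb (Q `\` D)))%:E by rewrite fineK// ge0_fin_numE.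
apply/le_anti; rewrite c_ge1 andbT.
move: leQ lebQE; rewrite nuQ lebQ lebDE QDE -EFinM -!EFinD lee_fin => leQ [volE].
move: leQ; rewrite volE mulrDr lerD2r -{2}[fine (leb D)]mul1r ler_pM2r//.
Qed.

(** Inside the ball, the case of a null ball is trivial, both sides being 0. Otherwise the
    inequality applied to [C] and to its preimage gives equality, the reflection being an
    involution. *)
Lemma lebesgue_outer_reflection (C : set V) : measurable C ->
  C `<=` punctured_ball -> leb (T @^-1` C) = leb C.
Proof.
move=> mC CD; have [D0|D0] := eqVneq (leb punctured_ball) 0%E.
  have null A : A `<=` punctured_ball -> leb A = 0%E.
    move=> AD; apply/eqP; rewrite eq_le outer_measure_ge0 andbT -D0.
    exact: le_outer_measure.
  rewrite !null// => x /CD; by rewrite /punctured_ball/= dot_reflection.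
apply/le_anti/andP; split; first exact: le_lebesgue_outer_reflection.
have mTC : measurable (T @^-1` C).
  by rewrite -[X in measurable X]setTI; exact: measurable_reflection.
have := le_lebesgue_outer_reflection _ D0 mTC.
rewrite -comp_preimage (_ : T \o T = id)//; apply/funext => x /=.
exact: reflectionK.
Qed.

End lebesgue_reflection.

(** * Surface measure *)

Section surface_measure.
Context {R : realType} {n : nat}.
Local Notation V := (n.+1.-tuple R).
Local Notation leb := (@lebesgue_outer R n.+1).

Definition normalize (y : V) : V := scale (Num.sqrt (dot y y))^-1 y.

Lemma measurable_normalize : measurable_fun setT normalize.
Proof.
rewrite (_ : normalize = fun y => scale (dot y y `^ (- 2^-1)) y).
  apply: measurable_scale; apply: (measurableT_comp (measurable_powR _)).
  exact: measurable_dot_diag.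
by apply/funext => y; rewrite powRN powR12_sqrt// dot_ge0.
Qed.

(** Replaces a union over radii by a preimage, which exhibits [surface] as a pushforward of a
    restricted measure. *)
Lemma coneE (A : set V) : cone A = normalize @^-1` A `&` punctured_ball.
Proof.
rewrite /normalize; apply/seteqP; split => y /=.
  move=> [r [x [/andP[r0 r1] [[Ax x1] ->]]]].
  rewrite /punctured_ball /= dot_scale x1 mulr1 sqrtr_sqr gtr0_norm//.
  rewrite exprn_gt0// expr_le1 ?(ltW r0)// r1; split => //.
  suff -> : scale r^-1 (scale r x) = x by [].
  by apply: eq_from_tnth => i; rewrite !tnth_map mulKf// gt_eqF.
move=> [Ay /andP[y0 y1]]; exists (Num.sqrt (dot y y)), (scale (Num.sqrt (dot y y))^-1 y).
have s0 : 0 < Num.sqrt (dot y y) by rewrite sqrtr_gt0.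
split; first by rewrite s0 -(sqrtr1 R) ler_sqrt.
split; last by apply: eq_from_tnth => i; rewrite !tnth_map mulVKf// gt_eqF.
split => //; rewrite /sphere/= dot_scale exprVn sqr_sqrtr ?mulVf ?gt_eqF//.
exact: ltW.
Qed.

Let surface_aux : {measure set V -> \bar R} :=
  mscale (n.+1%:R%:nng : {nonneg R})
    (pushforward_measure (mrestr leb measurable_punctured_ball) normalize
      measurable_normalize).

Let surfaceE : @surface R n.+1 = surface_aux.
Proof. by apply/funext => A; rewrite /surface coneE. Qed.

Let surface0 : @surface R n.+1 set0 = 0%E.
Proof. by rewrite surfaceE measure0. Qed.

Let surface_ge0 A : (0 <= @surface R n.+1 A)%E.
Proof. by rewrite surfaceE. Qed.

Let surface_sigma_additive : semi_sigma_additive (@surface R n.+1).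
Proof. by rewrite surfaceE; exact: measure_semi_sigma_additive. Qed.

HB.instance Definition _ := isMeasure.Build _ V R (@surface R n.+1)
  surface0 surface_ge0 surface_sigma_additive.

Let surface_fin_num : fin_num_fun (@surface R n.+1).
Proof.
move=> A mA; rewrite ge0_fin_numE// /surface lte_mul_pinfty ?lee_fin//.
apply: le_lt_trans (lebesgue_outer_box_lty [tuple - 2 | i < n.+1] [tuple 2 | i < n.+1]).
rewrite coneE; apply: le_outer_measure.
by apply: subset_trans _ punctured_ball_box; exact: subIsetr.
Qed.

HB.instance Definition _ :=
  Measure_isFinite.Build _ V R (@surface R n.+1) surface_fin_num.

Lemma surface_setI_sphere (A : set V) : surface (A `&` sphere) = surface A.
Proof.
rewrite /surface; congr (_ * leb _)%E.
by rewrite /cone -setIA setIid.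
Qed.

(** A reflection is linear and preserves norms, so it commutes with [normalize] and maps cones to
    cones. *)
Lemma surface_reflection v (A : set V) : measurable A ->
  surface (reflection v @^-1` A) = surface A.
Proof.
move=> mA; rewrite /surface; congr (_ * _)%E.
rewrite -[RHS](lebesgue_outer_reflection v).
- rewrite !coneE preimage_setI; congr leb; congr setI.
    rewrite -[LHS]/((reflection v \o normalize) @^-1` A).
    rewrite -[RHS]/((normalize \o reflection v) @^-1` A).
    congr (_ @^-1` A); apply/funext => y /=.
    rewrite /normalize dot_reflection; apply: eq_from_tnth => i.
    rewrite !(tnth_mktuple, tnth_map); set r := _^-1.
    have -> : dot v (scale r y) = r * dot v y.
      by rewrite /dot mulr_sumr; apply: eq_bigr => j _; rewrite tnth_map; ring.
    by ring.
  by apply/seteqP; split => y; rewrite /punctured_ball/= dot_reflection.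
- rewrite coneE; apply: measurableI; last exact: measurable_punctured_ball.
  by rewrite -[X in measurable X]setTI; exact: measurable_normalize.
- by rewrite coneE; exact: subIsetr.
Qed.

Lemma Sint_reflection v (f : V -> R) : measurable_fun setT f ->
  (forall x, 0 <= f x) -> Sint (f \o reflection v) = Sint f.
Proof.
move=> mf f0; rewrite /Sint; congr fine.
transitivity (\int[pushforward (@surface R n.+1) (reflection v)]_(x in sphere) (f x)%:E)%E.
  rewrite ge0_integral_pushforward//.
  - congr integral; apply/seteqP; split => x;
    by rewrite /sphere /= dot_reflection.
  - exact: measurable_reflection.
  - exact: measurable_sphere.
  - by apply/measurable_EFinP; apply: measurable_funTS.
  - by move=> x _; rewrite lee_fin.
apply: (@eq_measure_integral _ _ _ _ (@surface R n.+1) (pushforward_measure (@surface R n.+1)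
  (reflection v) (measurable_reflection v))) => A mA _.
by rewrite /= /pushforward surface_reflection.
Qed.

Lemma Cp_sphere kappa (x y : V) : sphere x -> sphere y ->
  Cp kappa x = Cp kappa y.
Proof.
move=> x1 y1; rewrite /Cp.
pose v := translate (opp_tuple y) x.
rewrite -(Sint_reflection v (fun zt => expR (kappa * dot zt x))).
- congr Sint; apply/funext => z /=; congr (expR (_ * _)).
  rewrite -(@reflection_swap _ _ x y); last by rewrite x1 y1.
  by rewrite -[in RHS](reflectionK v z) dot_reflection.
- apply: measurableT_comp => //; apply: measurable_funM => //.
  exact: measurableT_comp measurable_dot (measurable_fun_pair _ _).
- by move=> z; rewrite expR_ge0.
Qed.

End surface_measure.

Set Implicit Arguments.
Unset Strict Implicit.

(** * Strong law of large numbers for bounded functions *)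

Section bounded_measurable.
Context {R : realType} {d} {T : measurableType d}.

(** Such functions are integrable against every finite measure, so integrability conditions reduce
    to closure properties of this class. *)
Definition bounded_measurable (f : T -> R) :=
  measurable_fun [set: T] f /\ exists C, forall x, `|f x| <= C.

Lemma bounded_measurable_cst r : bounded_measurable (cst r).
Proof. by split; [exact: measurable_cst|exists `|r|]. Qed.

Lemma bounded_measurableD f g : bounded_measurable f -> bounded_measurable g ->
  bounded_measurable (fun x => f x + g x).
Proof.
move=> [mf [C fC]] [mg [D gD]]; split; first exact: measurable_funD.
by exists (C + D) => x; rewrite (le_trans (ler_normD _ _))// lerD.
Qed.

Lemma bounded_measurableM f g : bounded_measurable f -> bounded_measurable g ->
  bounded_measurable (fun x => f x * g x).
Proof.
move=> [mf [C fC]] [mg [D gD]]; split; first exact: measurable_funM.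
by exists (C * D) => x; rewrite normrM ler_pM.
Qed.

Lemma bounded_measurable_sum (I : Type) (s : seq I) (f : I -> T -> R) :
  (forall i, bounded_measurable (f i)) ->
  bounded_measurable (fun x => \sum_(i <- s) f i x).
Proof.
move=> bf; elim: s => [|i s IH].
  by under eq_fun do rewrite big_nil; exact: bounded_measurable_cst.
by under eq_fun do rewrite big_cons; exact: bounded_measurableD.
Qed.

Variable mu : {finite_measure set T -> \bar R}.

Lemma bounded_measurable_integrable D f : measurable D ->
  bounded_measurable f -> mu.-integrable D (EFin \o f).
Proof.
move=> mD [mf [C fC]]; apply: measurable_bounded_integrable => //.
- by rewrite ltey_eq fin_num_measure.
- exact: measurable_funTS.
- exists C; split; first exact: num_real.
  by move=> x Cx y _; apply: (le_trans (fC y)); exact: ltW.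
Qed.

Lemma Rintegral_sum D (I : Type) (s : seq I) (f : I -> T -> R) : measurable D ->
  (forall i, bounded_measurable (f i)) ->
  Rintegral mu D (fun x => \sum_(i <- s) f i x) =
  \sum_(i <- s) Rintegral mu D (f i).
Proof.
move=> mD bf; elim: s => [|i s IH].
  under eq_Rintegral do rewrite big_nil.
  by rewrite Rintegral_cst// mul0r big_nil.
under eq_Rintegral do rewrite big_cons.
rewrite RintegralD//; last 2 first.
- exact: bounded_measurable_integrable.
- by apply: bounded_measurable_integrable => //; exact: bounded_measurable_sum.
by rewrite IH big_cons.
Qed.

End bounded_measurable.

Lemma bounded_measurable_comp {R : realType} {d1 d2} {T1 : measurableType d1}
  {T2 : measurableType d2} (W : T1 -> T2) (f : T2 -> R) :
  measurable_fun setT W -> bounded_measurable f -> bounded_measurable (f \o W).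
Proof.
move=> mW [mf [C fC]]; split; first exact: measurableT_comp.
by exists C => x; exact: fC.
Qed.

Lemma Rintegral_probability_cst {R : realType} {d} {T : measurableType d}
  (P : probability T R) r : Rintegral P setT (fun=> r) = r.
Proof.
rewrite Rintegral_cst// -[RHS]mulr1; congr (_ * _).
by have /(congr1 fine) := probability_setT P.
Qed.

Section average_along_squares.
Context {R : realType}.

Lemma nat_sandwich_squares N : (0 < N)%N ->
  exists k, (k.+1 ^ 2 <= N < k.+2 ^ 2)%N.
Proof.
elim: N => // -[_ _|N /(_ isT)[k /andP[k1 k2]] _]; first by exists 0%N.
have [h|h] := ltnP N.+2 (k.+2 ^ 2).
  by exists k; rewrite h andbT; exact: leq_trans k1 _.
exists k.+1; rewrite h /=; lia.
Qed.

(** Telescoping: [x ^- 2 <= 2 / x - 2 / (x + 1)] holds from [x = 1] on. *)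
Lemma sum_inv_squares_le (n : nat) : \sum_(0 <= k < n) (k.+1%:R ^- 2) <= 2 - 2 / n.+1%:R :> R.
Proof.
elim: n => [|n IH]; first by rewrite big_geq// divr1 subrr.
rewrite big_nat_recr//=; apply: (le_trans (lerD IH (lexx _))).
rewrite -[n.+2]addn1 natrD; have n0 : 0 < n.+1%:R :> R by rewrite ltr0n.
have n1 : 1 <= n.+1%:R :> R by rewrite ler1n.
move: (n.+1%:R) n0 n1 => x x0 x1.
have x10 : 0 < x + 1 by lra.
rewrite -subr_ge0; have -> : 2 - 2 / (x + 1) - (2 - 2 / x + x ^- 2) =
  (x - 1) / (x ^+ 2 * (x + 1)) by field; rewrite ?gt_eqF.
by rewrite divr_ge0 ?subr_ge0// mulr_ge0 ?exprn_ge0 ?ltW.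
Qed.

(** At most [2 * k.+1] terms separate [k.+1 ^ 2] from an [N] below the next square; they add at most
    [2 * C / k.+1] to the mean. The hypothesis is on squares because second moments control
    those. *)
Lemma cvg_average_squares (z : nat -> R) C : (forall i, `|z i| <= C) ->
  (fun k => ((\sum_(i < k.+1 ^ 2) z i) / (k.+1 ^ 2)%:R) ^+ 2) @ \oo --> 0 ->
  (fun N => N%:R^-1 * \sum_(i < N) z i) @ \oo --> 0.
Proof.
move=> zC /cvgr0Pnorm_lt zsq; apply/cvgr0Pnorm_le => e e0.
have C0 : 0 <= C := le_trans (normr_ge0 _) (zC 0%N).
have [K _ HK] : \forall k \near \oo,
    `|((\sum_(i < k.+1 ^ 2) z i) / (k.+1 ^ 2)%:R) ^+ 2| < (e / 2) ^+ 2.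
  by apply: zsq; rewrite exprn_gt0// divr_gt0.
(* From [4 * C / e] on, the terms after the last square contribute at most [e / 2]. *)
pose K' := maxn K (Num.truncn (4 * C / e)).
exists (K'.+1 ^ 2)%N => // N /= KN.
have N0 : (0 < N)%N by apply: leq_trans KN; rewrite expn_gt0.
have [k /andP[k1 k2]] := nat_sandwich_squares N0.
have Kk : (K' <= k)%N.
  by have := leq_ltn_trans KN k2; rewrite ltn_sqr ltnS.
have Kk1 : (K <= k)%N by rewrite (leq_trans (leq_maxl _ _) Kk).
have Ck : 4 * C / e <= k.+1%:R.
  apply: ltW; apply: lt_le_trans (truncnS_gt _) _.
  by rewrite ler_nat ltnS (leq_trans (leq_maxr _ _) Kk).
have q0 : 0 < (k.+1 ^ 2)%:R :> R by rewrite ltr0n expn_gt0.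
have Sk : `|\sum_(i < k.+1 ^ 2) z i| <= e / 2 * (k.+1 ^ 2)%:R.
  have := HK _ Kk1; rewrite /= normrX => h.
  have : `|(\sum_(i < k.+1 ^ 2) z i) / (k.+1 ^ 2)%:R| < e / 2.
    by rewrite -ltr_sqr ?nnegrE ?normr_ge0// divr_ge0// ltW.
  by rewrite normrM normfV (gtr0_norm q0) ltr_pdivrMr// => /ltW.
have SN : `|\sum_(i < N) z i| <= `|\sum_(i < k.+1 ^ 2) z i| + C * (N - k.+1 ^ 2)%:R.
  rewrite -(big_mkord xpredT z) (big_cat_nat (n := (k.+1 ^ 2)%N))//= big_mkord.
  apply: le_trans (ler_normD _ _) _; rewrite lerD2l.
  apply: le_trans (ler_norm_sum _ _ _) _.
  apply: (le_trans (ler_sum _ (fun i _ => zC i))).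
  by rewrite sumr_const_nat mulr_natr.
have Nk : ((N - k.+1 ^ 2)%:R <= 2 * k.+1%:R :> R).
  by rewrite -natrM ler_nat; lia.
have N0' : 0 < N%:R :> R by rewrite ltr0n.
rewrite normrM normfV (gtr0_norm N0') mulrC ler_pdivrMr//.
apply: le_trans SN _.
have kN : (k.+1 ^ 2)%:R <= N%:R :> R by rewrite ler_nat.
have h1 : C * (N - k.+1 ^ 2)%:R <= C * (2 * k.+1%:R) by rewrite ler_wpM2l.
have h2 : 4 * C <= k.+1%:R * e by rewrite -ler_pdivrMr.
have h3 : 4 * C * k.+1%:R <= k.+1%:R * e * k.+1%:R by rewrite ler_wpM2r.
have h4 : e * (k.+1 ^ 2)%:R <= e * N%:R by rewrite ler_wpM2l// ltW.
have kE : (k.+1 ^ 2)%:R = k.+1%:R * k.+1%:R :> R by rewrite -natrM mulnn.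
by rewrite kE in Sk h4; nra.
Qed.

End average_along_squares.

Section strong_law.
Context {R : realType} {dO : measure_display} {Omega : measurableType dO}.
Variable P : probability Omega R.
Context {dT : measure_display} {T : measurableType dT}.
Variable W : nat -> Omega -> T.
Hypothesis iidW : iid_seq P W.

Let mW i : measurable_fun setT (W i). Proof. by case: iidW. Qed.

(** Independence is given on rectangles; uniqueness of the product measure upgrades it to the joint
    law of [(W i, W j)], and Fubini's theorem factors the integral. *)
Lemma iid_Rintegral_mul (f : T -> R) i j : i != j -> bounded_measurable f ->
  Rintegral P setT (fun w => f (W i w) * f (W j w)) =
  Rintegral P setT (f \o W 0%N) ^+ 2.
Proof.
move=> ij bf; have [_ idW indepW] := iidW.
pose X : {mfun Omega >-> T} := HB.pack (W 0%N) (isMeasurableFun.Build _ _ _ _ _ (mW 0%N)).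
pose D : probability T R := distribution P X.
pose Wij w := (W i w, W j w).
have mWij : measurable_fun setT Wij by exact: measurable_fun_pair.
pose L := pushforward_measure P Wij mWij.
have LE A : measurable A -> (D \x D)%E A = L A.
  apply: product_measure_unique => B1 B2 mB1 mB2.
  rewrite /L /= /pushforward.
  have := indepW [:: i; j] (fun k => if k == i then B1 else B2).
  rewrite big_cons big_seq1 eqxx eq_sym (negbTE ij) idW// (idW j)// => <-.
  - congr (P _); apply/seteqP; split => w /=.
      by move=> [w1 w2] k /=; rewrite !inE => /orP[]/eqP->; rewrite ?eqxx// eq_sym (negbTE ij).
    move=> h; split; first by have := h i; rewrite /= mem_head eqxx; exact.
    by have := h j; rewrite /= !inE eqxx orbT eq_sym (negbTE ij); exact.
  - by rewrite /= inE ij.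
  - by move=> k; case: ifP.
pose phi (x : T * T) := f x.1 * f x.2.
have bphi : bounded_measurable phi.
  apply: bounded_measurableM.
    exact: (bounded_measurable_comp (W := fst)).
  exact: (bounded_measurable_comp (W := snd)).
have DE : (\int[D]_x (f x)%:E = \int[P]_w ((f \o W 0%N) w)%:E)%E.
  rewrite /D integral_distribution//; first by apply/measurable_EFinP; case: bf.
  by apply: bounded_measurable_integrable => //; exact: (bounded_measurable_comp (W := W 0%N)).
have intf : D.-integrable setT (EFin \o f) by exact: bounded_measurable_integrable.
rewrite /Rintegral.
have -> : (\int[P]_w (f (W i w) * f (W j w))%:E = \int[L]_x (phi x)%:E)%E.
  rewrite /L integral_pushforward//.
    by apply/measurable_EFinP; case: bphi.
  apply: (@bounded_measurable_integrable _ _ _ P setT (phi \o Wij)) => //.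
  exact: bounded_measurable_comp.
rewrite (eq_measure_integral (D \x D)%E); last first.
  by move=> A mA _; exact/esym/LE.
rewrite -(integral12_prod_meas1 (f := fun x => (phi x)%:E)); last first.
  have [mphi [C phiC]] := bphi.
  apply: measurable_bounded_integrable => //.
    have : ((D \x D)%E ([set: T] `*` [set: T]) < +oo)%E.
      rewrite product_measure1E//; have D1 : D setT = 1%E := probability_setT D.
      by rewrite [X in (X * X)%E](D1 : _ = 1%E) mul1e ltry.
    by rewrite setXTT.
  exists C; split; first exact: num_real.
  by move=> x Cx y _; apply: (le_trans (phiC y)); exact: ltW.
pose m := Rintegral D setT f.
have mE : m = Rintegral P setT (f \o W 0%N) by rewrite /m /Rintegral DE.
rewrite (eq_integral (fun x => (f x * m)%:E)).
  by rewrite -/(Rintegral D setT _) RintegralZr// -/m mE.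
move=> x _; rewrite /fubini_F /phi /= -[LHS]fineK.
  by rewrite -/(Rintegral D setT _) RintegralZl.
apply: integrable_fin_num => //.
apply: (@bounded_measurable_integrable _ _ _ D setT (fun y => f x * f y)) => //.
exact: bounded_measurableM (bounded_measurable_cst _) bf.
Qed.

(** Centering kills the cross terms, so only the [N] diagonal ones remain. *)
Lemma iid_second_moment_le (f : T -> R) C N : bounded_measurable f ->
  (forall x, `|f x| <= C) -> Rintegral P setT (f \o W 0%N) = 0 ->
  Rintegral P setT (fun w => (\sum_(i < N) f (W i w)) ^+ 2) <= N%:R * C ^+ 2.
Proof.
move=> bf fC f0.
have bfW i : bounded_measurable (f \o W i) by exact: bounded_measurable_comp.
have bS n : bounded_measurable (fun w => \sum_(i < n) f (W i w)).
  exact: (@bounded_measurable_sum _ _ _ _ _ (fun i : 'I_n => f \o W i)).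
elim: N => [|N IH].
  under eq_Rintegral do rewrite big_ord0 expr0n.
  by rewrite Rintegral_cst// mul0r mul0r.
have cross : Rintegral P setT (fun w => (\sum_(i < N) f (W i w)) * f (W N w)) = 0.
  under eq_Rintegral do rewrite mulr_suml.
  rewrite (@Rintegral_sum _ _ _ P setT _ (index_enum 'I_N)
    (fun i w => f (W i w) * f (W N w)))//.
    by apply: big1 => i _; rewrite iid_Rintegral_mul ?f0 ?expr0n// ltn_eqF.
  by move=> i; exact: bounded_measurableM (bfW i) (bfW N).
rewrite (@eq_Rintegral _ _ _ P setT (fun w => (\sum_(i < N) f (W i w)) ^+ 2 +
    (2 * ((\sum_(i < N) f (W i w)) * f (W N w)) + f (W N w) ^+ 2))); last first.
  by move=> w _; rewrite big_ord_recr/=; ring.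
have b1 : bounded_measurable (fun w => (\sum_(i < N) f (W i w)) ^+ 2).
  exact: bounded_measurableM.
have b2 : bounded_measurable (fun w => (\sum_(i < N) f (W i w)) * f (W N w)).
  exact: bounded_measurableM (bS N) (bfW N).
have b3 : bounded_measurable (fun w => f (W N w) ^+ 2).
  exact: bounded_measurableM (bfW N) (bfW N).
have b2' : bounded_measurable (fun w => 2 * ((\sum_(i < N) f (W i w)) * f (W N w))).
  exact: bounded_measurableM (bounded_measurable_cst _) b2.
have bint g : bounded_measurable g -> P.-integrable setT (EFin \o g).
  exact: bounded_measurable_integrable.
rewrite RintegralD//; [|exact: bint|exact/bint/bounded_measurableD].
rewrite RintegralD//; [|exact: bint|exact: bint].
rewrite RintegralZl//; last exact: bint.
rewrite cross mulr0 add0r -natr1 mulrDl mul1r lerD//.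
have -> : C ^+ 2 = Rintegral P setT (cst (C ^+ 2)).
  exact/esym/Rintegral_probability_cst.
apply: le_Rintegral => //; [exact: bint|exact/bint/bounded_measurable_cst|].
move=> w _; rewrite -[f _ ^+ 2]real_normK ?num_real// lerXn2r// nnegrE.
exact: le_trans (fC (W N w)).
Qed.

(* The second moments of the centered means along [N = k ^ 2] are summable, so
   these means tend to 0 almost surely; boundedness fills the gaps. *)
Lemma strong_law_bounded (f : T -> R) : bounded_measurable f ->
  {ae P, forall w, (fun N => N%:R^-1 * \sum_(i < N) f (W i w)) @ \oo -->
    Rintegral P setT (f \o W 0%N)}.
Proof.
move=> bf; set m := Rintegral _ _ _.
pose g x := f x - m.
have bg : bounded_measurable g.
  exact: bounded_measurableD bf (bounded_measurable_cst (- m)).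
have [mg [C gC]] := bg.
have bint h : bounded_measurable h -> P.-integrable setT (EFin \o h).
  exact: bounded_measurable_integrable.
have g0 : Rintegral P setT (g \o W 0%N) = 0.
  rewrite /g /= RintegralB//; last 2 first.
  - by apply: bint; exact: (bounded_measurable_comp (W := W 0%N)).
  - by apply: bint; exact: (bounded_measurable_cst m).
  by rewrite Rintegral_probability_cst subrr.
pose A k w := ((\sum_(i < k.+1 ^ 2) g (W i w)) / (k.+1 ^ 2)%:R) ^+ 2.
have bS n : bounded_measurable (fun w => \sum_(i < n) g (W i w)).
  apply: (@bounded_measurable_sum _ _ _ _ _ (fun i : 'I_n => g \o W i)) => i.
  exact: bounded_measurable_comp.
have bS2 n : bounded_measurable (fun w => (\sum_(i < n) g (W i w)) ^+ 2).
  exact: bounded_measurableM.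
have AE k : A k = (fun w => (k.+1 ^ 2)%:R ^- 2 * (\sum_(i < k.+1 ^ 2) g (W i w)) ^+ 2).
  by apply/funext => w; rewrite /A expr_div_n mulrC.
have bA k : bounded_measurable (A k).
  by rewrite AE; exact: bounded_measurableM (bounded_measurable_cst _) _.
have A0 k w : 0 <= A k w by exact: sqr_ge0.
have intA k : (\int[P]_w (A k w)%:E <= (C ^+ 2 * k.+1%:R ^- 2)%:E)%E.
  rewrite -[leLHS]fineK; last exact: integrable_fin_num (bint _ (bA k)).
  rewrite lee_fin -/(Rintegral P setT (A k)) AE RintegralZl//; last exact: bint.
  apply: le_trans (ler_wpM2l _ (iid_second_moment_le _ bg gC g0)) _.
    by rewrite invr_ge0 exprn_ge0.
  have k0 : 0 < k.+1%:R :> R by rewrite ltr0n.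
  by rewrite le_eqVlt; apply/orP; left; apply/eqP; rewrite natrX; field; rewrite gt_eqF.
(* The integral of [F] is at most [C ^+ 2 * 2], so [F] is finite almost everywhere, and there the
   terms [A k] tend to 0. *)
pose F w := (\sum_(k <oo) (A k w)%:E)%E.
have mA k : measurable_fun setT (fun w => (A k w)%:E).
  by apply/measurable_EFinP; case: (bA k).
have intF : P.-integrable setT F.
  apply/integrableP; split.
    by apply: ge0_emeasurable_sum => // k w _ _; rewrite lee_fin.
  rewrite (eq_integral F); last first.
    by move=> w _; rewrite gee0_abs//; apply: nneseries_ge0 => k _ _; rewrite lee_fin.
  rewrite integral_nneseries//; last by move=> k w _; rewrite lee_fin.
  apply: (@le_lt_trans _ _ (C ^+ 2 * 2)%:E); last by rewrite ltry.
  apply: (le_trans (lee_nneseries _ (fun k _ => intA k))).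
    by move=> k _ _; apply: integral_ge0 => w _; rewrite lee_fin.
  apply: lime_le.
    apply: is_cvg_nneseries => k _ _.
    by rewrite lee_fin mulr_ge0 ?sqr_ge0// invr_ge0 exprn_ge0.
  apply: nearW => n; rewrite sumEFin lee_fin -mulr_sumr ler_wpM2l ?sqr_ge0//.
  apply: le_trans (sum_inv_squares_le n) _.
  by rewrite gerBl divr_ge0.
have := integrable_ae measurableT intF; apply: filterS => w /(_ I) Ffin.
have Aw0 : A ^~ w @ \oo --> 0.
  apply: cvg_series_cvg_0; apply: nondecreasing_is_cvgn.
    by apply: nondecreasing_series => k _ _; exact: A0.
  exists (fine (F w)) => _ [n _ <-].
  rewrite -lee_fin fineK// /series/= -sumEFin.
  by apply: (nneseries_lim_ge (u_ := fun k => (A k w)%:E)) => k _ _; rewrite lee_fin.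
have := cvg_average_squares (z := fun i => g (W i w)) (fun i => gC _) Aw0.
move=> /(cvgD (cvg_cst m)); rewrite addr0; apply: cvg_trans.
apply: near_eq_cvg; near=> N.
have N0 : N%:R != 0 :> R by rewrite pnatr_eq0 -lt0n; near: N; exists 1%N.
rewrite fctE sumrB sumr_const card_ord -[m *+ N]mulr_natr mulrBr.
by rewrite [X in _ - X]mulrCA mulVf// mulr1 addrC subrK.
Unshelve. all: by end_near. Qed.

End strong_law.

(** * Densities and integrals over the sphere *)

Section density.
Context {R : realType} {d} {T : measurableType d}.

(** The proofs are arguments so that the measure structure can be attached to the term. *)
Definition density_measure (mu : {measure set T -> \bar R}) (rho : T -> R)
    (mrho : measurable_fun setT rho) (rho0 : forall x, 0 <= rho x)
    (A : set T) : \bar R :=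
  (\int[mu]_(x in A) (rho x)%:E)%E.

Section density_measure.
Variables (mu : {measure set T -> \bar R}) (rho : T -> R).
Hypotheses (mrho : measurable_fun setT rho) (rho0 : forall x, 0 <= rho x).
Local Notation m := (density_measure mu mrho rho0).

Let m0 : m set0 = 0%E. Proof. exact: integral_set0. Qed.

Let m_ge0 A : (0 <= m A)%E.
Proof. by apply: integral_ge0 => x _; rewrite lee_fin. Qed.

Let m_sigma_additive : semi_sigma_additive m.
Proof.
move=> F mF tF mUF; rewrite /density_measure ge0_integral_bigcup//; last 2 first.
- by apply/measurable_EFinP; exact: measurable_funTS.
- by move=> x _; rewrite lee_fin.
by apply: is_cvg_nneseries => k _ _; exact: m_ge0.
Qed.

HB.instance Definition _ := isMeasure.Build _ T R m m0 m_ge0 m_sigma_additive.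

End density_measure.

(** [rho] and the Radon-Nikodym derivative of [nu] have the same integral over every measurable set,
    hence agree almost everywhere; the change of variables for the derivative then transfers to
    [rho]. *)
Lemma integral_density (mu : {sigma_finite_measure set T -> \bar R})
    (nu : {finite_measure set T -> \bar R}) (rho : T -> R) (f : T -> \bar R) :
  measurable_fun setT rho ->
  (forall A, measurable A -> nu A = \int[mu]_(x in A) (rho x)%:E)%E ->
  nu.-integrable setT f ->
  (\int[nu]_x f x = \int[mu]_x (f x * (rho x)%:E))%E.
Proof.
move=> mrho nuE intf.
have numu : nu `<< mu.
  apply/null_content_dominatesP => A mA muA; rewrite nuE//.
  apply: null_set_integral => //; apply/measurable_EFinP; exact: measurable_funTS.
rewrite -(Radon_Nikodym_change_of_variables numu)//.
have mf : measurable_fun setT f by exact: measurable_int intf.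
have mrhoE : measurable_fun setT (fun x => (rho x)%:E) by exact/measurable_EFinP.
have mD : measurable_fun setT (Radon_Nikodym (charge_of_finite_measure nu) mu).
  by apply: measurable_int; exact: Radon_Nikodym_integrable.
apply: ae_eq_integral => //; try exact: emeasurable_funM.
apply: ae_eqe_mul2l; apply: integral_ae_eq => //.
  exact: Radon_Nikodym_integrable.
by move=> E _ mE; rewrite -Radon_Nikodym_integral// -nuE.
Qed.

End density.

Section surface_integrals.
Context {R : realType} {n : nat}.
Local Notation V := (n.+1.-tuple R).
Local Notation sigma := (@surface R n.+1).
Implicit Types f : V -> R.

Lemma SintE f : Sint f = Rintegral sigma sphere f. Proof. by []. Qed.

Lemma surface_sphereC : sigma (~` sphere) = 0%E.
Proof. by rewrite -surface_setI_sphere setICl measure0. Qed.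

(** The complement of the sphere is null; on the whole space Fubini's theorem applies. *)
Lemma SintT f : bounded_measurable f -> Sint f = Rintegral sigma setT f.
Proof.
move=> bf; rewrite SintE /Rintegral; congr fine.
rewrite [RHS](@negligible_integral _ _ _ _ _ (~` sphere))//.
- by rewrite setTD setCK.
- exact: measurableC measurable_sphere.
- exact: bounded_measurable_integrable.
- exact: surface_sphereC.
Qed.

Lemma Sint_cst (r : R) : Sint (fun _ : V => r) = r * Zarea R n.+1.
Proof. by rewrite SintE Rintegral_cst//; exact: measurable_sphere. Qed.

Lemma eq_Sint f g : (forall x, sphere x -> f x = g x) -> Sint f = Sint g.
Proof.
by move=> fg; rewrite !SintE; apply: eq_Rintegral => x; rewrite inE => /fg.
Qed.

Lemma SintZ r f : bounded_measurable f -> Sint (fun x => r * f x) = r * Sint f.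
Proof.
move=> bf; rewrite !SintE RintegralZl//; first exact: measurable_sphere.
by apply: bounded_measurable_integrable => //; exact: measurable_sphere.
Qed.

Lemma SintD f g : bounded_measurable f -> bounded_measurable g ->
  Sint (fun x => f x + g x) = Sint f + Sint g.
Proof.
move=> bf bg; rewrite !SintE RintegralD//; first exact: measurable_sphere.
all: by apply: bounded_measurable_integrable => //; exact: measurable_sphere.
Qed.

Lemma le_Sint f g : bounded_measurable f -> bounded_measurable g ->
  (forall x, sphere x -> f x <= g x) -> Sint f <= Sint g.
Proof.
move=> bf bg fg; rewrite !SintE; apply: le_Rintegral => //.
  exact: measurable_sphere.
all: by apply: bounded_measurable_integrable => //; exact: measurable_sphere.
Qed.

Lemma bounded_measurable_section (f : V * V -> R) a :
  bounded_measurable f -> bounded_measurable (fun b => f (a, b)).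
Proof.
move=> bf; apply: (bounded_measurable_comp (W := fun b => (a, b))) => //.
exact: measurable_fun_pair.
Qed.

Lemma product_surface_lty : (((sigma \x sigma) [set: V * V])%E < +oo)%E.
Proof.
have : ((sigma \x sigma)%E ([set: V] `*` [set: V]) < +oo)%E.
  rewrite product_measure1E//.
  by rewrite lte_mul_pinfty// ?fin_num_measure// ltey_eq fin_num_measure.
by rewrite setXTT.
Qed.

(* A name for the product measure, on which its finiteness can be registered. *)
Definition surface_product : set (V * V) -> \bar R := (sigma \x sigma)%E.

HB.instance Definition _ := Measure.on surface_product.

Let surface_product_fin_num : fin_num_fun surface_product.
Proof.
by apply: lty_fin_num_fun; exact: product_surface_lty.
Qed.

HB.instance Definition _ := @Measure_isFinite.Build _ _ R surface_product
  surface_product_fin_num.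

Lemma bounded_measurable_integrable_prod (f : V * V -> R) :
  bounded_measurable f -> (sigma \x sigma)%E.-integrable setT (EFin \o f).
Proof.
move=> [mf [C fC]]; apply: measurable_bounded_integrable => //.
  exact: product_surface_lty.
exists C; split; first exact: num_real.
by move=> x Cx y _; apply: (le_trans (fC y)); exact: ltW.
Qed.

Lemma bounded_measurable_Rintegral_section (f : V * V -> R) :
  bounded_measurable f ->
  bounded_measurable (fun a => Rintegral sigma setT (fun b => f (a, b))).
Proof.
move=> bf; split.
  have := measurable_fubini_F (bounded_measurable_integrable_prod bf).
  move=> m1; apply: (measurableT_comp _ m1); exact: fine_measurable.
have [mf [C fC]] := bf; exists (C * fine (sigma setT)) => a.
have bfa := bounded_measurable_section a bf.
have intfa : sigma.-integrable setT (EFin \o (fun b => f (a, b))).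
  exact: bounded_measurable_integrable.
apply: le_trans (le_normr_Rintegral _ intfa) _ => //.
rewrite -Rintegral_cst//; apply: le_Rintegral => //.
- by apply: bounded_measurable_integrable => //; split;
    [apply: measurableT_comp => //; case: bfa|exists C => b; rewrite normr_id].
- by apply: bounded_measurable_integrable => //; exact: bounded_measurable_cst.
Qed.

Lemma Sint_Sint (f : V * V -> R) : bounded_measurable f ->
  fine (\int[sigma \x sigma]_p (f p)%:E)%E = Sint (fun a => Sint (fun b => f (a, b))).
Proof.
move=> bf.
have -> : (fun a => Sint (fun b => f (a, b))) =
    (fun a => Rintegral sigma setT (fun b => f (a, b))).
  by apply/funext => a; rewrite SintT//; exact: bounded_measurable_section.
rewrite SintT; last exact: bounded_measurable_Rintegral_section.
rewrite -(integral12_prod_meas1 (f := fun p => (f p)%:E)); last first.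
  exact: bounded_measurable_integrable_prod.
congr fine; apply: eq_integral => a _; rewrite /Rintegral fineK//.
apply: integrable_fin_num => //; apply: bounded_measurable_integrable => //.
exact: bounded_measurable_section.
Qed.

Lemma Sint_exchange (f : V * V -> R) : bounded_measurable f ->
  Sint (fun a => Sint (fun b => f (a, b))) =
  Sint (fun b => Sint (fun a => f (a, b))).
Proof.
move=> bf.
have bfs : bounded_measurable (fun p : V * V => f (p.2, p.1)).
  apply: (bounded_measurable_comp (W := fun p : V * V => (p.2, p.1))) => //.
  exact: measurable_fun_pair.
rewrite -Sint_Sint// -(Sint_Sint bfs).
congr fine; rewrite -(integral21_prod_meas1 (f := fun p => (f p)%:E)); last first.
  exact: bounded_measurable_integrable_prod.
rewrite -(integral12_prod_meas1 (f := fun p => (f (p.2, p.1))%:E))//.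
exact: bounded_measurable_integrable_prod.
Qed.

End surface_integrals.

(** * The law of the latent variables *)

Lemma bounded_measurable_indic {R : realType} {d} {T : measurableType d}
  (A : set T) : measurable A -> bounded_measurable (\1_A : T -> R).
Proof.
move=> mA; split; first exact: measurable_indic.
by exists 1 => x; rewrite indicE; case: (x \in A); rewrite ?normr1 ?normr0 ?ler01.
Qed.

Lemma bounded_measurable_expR {R : realType} {d} {T : measurableType d}
  (f : T -> R) : bounded_measurable f ->
  bounded_measurable (fun x => expR (f x)).
Proof.
move=> [mf [C fC]]; split; first exact: measurableT_comp.
exists (expR C) => x; rewrite ger0_norm ?expR_ge0// ler_expR.
exact: le_trans (ler_norm _) (fC x).
Qed.

Lemma bounded_measurable_ln {R : realType} {d} {T : measurableType d}
  (f : T -> R) e : 0 < e -> (forall x, e <= f x) -> bounded_measurable f ->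
  bounded_measurable (fun x => ln (f x)).
Proof.
move=> e0 ef [mf [C fC]]; split; first exact: measurableT_comp.
exists (`|ln e| + `|ln C|) => x.
have fx0 : 0 < f x by exact: lt_le_trans (ef x).
have fxC : f x <= C by exact: le_trans (ler_norm _) (fC x).
have C0 : 0 < C by exact: lt_le_trans fxC.
have h1 : ln e <= ln (f x) by rewrite ler_ln.
have h2 : ln (f x) <= ln C by rewrite ler_ln.
have := ler_norm (ln C); have := ler_norm (- ln e); rewrite normrN => h3 h4.
rewrite ler_norml; have := normr_ge0 (ln e); have := normr_ge0 (ln C).
by move=> ? ?; apply/andP; split; lra.
Qed.

Section bounded_vectors.
Context {R : realType} {M : nat}.
Local Notation V := (M.-tuple R).

(** The coordinatewise norm fits both the hypothesis on [h] and the rectangular grid of the uniform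
    law. *)
Definition bounded_by (B : R) (x : V) := forall i, `|tnth x i| <= B.

Lemma le_norm_dot (A B : R) (x y : V) : bounded_by A x -> bounded_by B y ->
  `|dot x y| <= M%:R * (A * B).
Proof.
move=> xA yB; apply: le_trans (ler_norm_sum _ _ _) _.
apply: (@le_trans _ _ (\sum_(i < M) A * B)).
  by apply: ler_sum => i _; rewrite normrM ler_pM.
by rewrite sumr_const card_ord mulr_natl.
Qed.

Lemma bounded_measurable_dot (h : V -> V) (B : R) : measurable_fun setT h ->
  (forall x, bounded_by B (h x)) ->
  bounded_measurable (fun p : V * V => dot (h p.1) (h p.2)).
Proof.
move=> mh hB; split.
  apply: (measurableT_comp measurable_dot
    (g := fun p : V * V => (h p.1, h p.2))) => /=.
  by apply: measurable_fun_pair; exact: measurableT_comp.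
by exists (M%:R * (B * B)) => p; exact: le_norm_dot.
Qed.

(* Outside the sphere the restricted map is constant, equal to [point]. *)
Lemma restrict_sphere_bounded (h : V -> V) : measurable_fun sphere h ->
  (exists B, forall z, sphere z -> bounded_by B (h z)) ->
  measurable_fun setT (h \_ sphere) /\
  exists B, forall z, bounded_by B ((h \_ sphere) z).
Proof.
move=> mh [B hB]; split.
  by apply/(measurable_restrictT _ measurable_sphere).
exists (Num.max B (\sum_i `|tnth (point : V) i|)) => z i.
rewrite patchE; case: ifPn => [/set_mem z1|_]; rewrite le_max.
  by rewrite hB.
by apply/orP; right; rewrite (bigD1 i)//= lerDl sumr_ge0.
Qed.

Lemma restrict_sphereE (h : V -> V) z : sphere z -> (h \_ sphere) z = h z.
Proof. by move=> z1; rewrite patchE mem_set. Qed.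

Lemma sphere_bounded_by (x : V) : sphere x -> bounded_by 1 x.
Proof.
move=> x1 i; rewrite -(ler_pXn2r (n := 2)) ?nnegrE// expr1n real_normK ?num_real//.
by apply: le_trans (sqr_coord_le_dot x i) _; rewrite x1.
Qed.

End bounded_vectors.

Section vmf.
Context {R : realType} {n : nat}.
Local Notation V := (n.+1.-tuple R).
Local Notation sigma := (@surface R n.+1).
Variable kappa : R.

(** Restricting [id] to the sphere keeps the kernel bounded on the whole space, while it stays
    symmetric. *)
Definition vmf_kernel (p : V * V) : R :=
  expR (kappa * dot ((id \_ sphere) p.1) ((id \_ sphere) p.2)).

Lemma bounded_measurable_vmf_kernel : bounded_measurable vmf_kernel.
Proof.
apply: bounded_measurable_expR.
apply: bounded_measurableM (bounded_measurable_cst _) _.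
have [||mid [B idB]] := @restrict_sphere_bounded R n.+1 id.
- exact: measurable_id.
- by exists 1 => z; exact: sphere_bounded_by.
exact: bounded_measurable_dot mid idB.
Qed.

Lemma vmf_kernelE a b : sphere a -> sphere b ->
  vmf_kernel (a, b) = expR (kappa * dot b a).
Proof. by move=> a1 b1; rewrite /vmf_kernel/= !restrict_sphereE// dotC. Qed.

Lemma vmf_kernelC a b : vmf_kernel (a, b) = vmf_kernel (b, a).
Proof. by rewrite /vmf_kernel /= dotC. Qed.

Lemma EFin_Sint (f : V -> R) : bounded_measurable f ->
  (\int[sigma]_(x in sphere) (f x)%:E = (Sint f)%:E)%E.
Proof.
move=> bf; rewrite /Sint fineK//; apply: integrable_fin_num => //.
  exact: measurable_sphere.
by apply: bounded_measurable_integrable => //; exact: measurable_sphere.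
Qed.

(** A reference centre: [Cp kappa] has the same value at all points of the sphere. *)
Definition pole : V := [tuple if i == ord0 then 1 else 0 | i < n.+1].

Lemma sphere_pole : sphere pole.
Proof.
rewrite /sphere/= /dot (bigD1 ord0)//= !tnth_mktuple eqxx mulr1 big1 ?addr0//.
by move=> i /negbTE i0; rewrite !tnth_mktuple i0 mulr0.
Qed.

Local Notation c := (Cp kappa pole).

Lemma Sint_vmf_kernel a : sphere a -> Sint (fun b => vmf_kernel (a, b)) = c.
Proof.
move=> a1; rewrite -(Cp_sphere kappa _ _ a1 sphere_pole).
by apply: eq_Sint => b b1; rewrite vmf_kernelE.
Qed.

Lemma Cp_gt0 : 0 < Zarea R n.+1 -> 0 < c.
Proof.
move=> Z0; rewrite -(Sint_vmf_kernel sphere_pole).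
have [_ [C wC]] := bounded_measurable_vmf_kernel.
(* The crude bound [n.+1 * (1 * 1)] on the dot product of two points of the sphere is enough for
   positivity. *)
pose e := expR (- (`|kappa| * (n.+1%:R * (1 * 1)))).
apply: (@lt_le_trans _ _ (Sint (fun _ : V => e))).
  by rewrite Sint_cst mulr_gt0 ?expR_gt0.
apply: le_Sint; [exact: bounded_measurable_cst| |].
  exact: bounded_measurable_section bounded_measurable_vmf_kernel.
move=> b b1; rewrite vmf_kernelE//; last exact: sphere_pole.
rewrite ler_expR -lerN2 opprK (le_trans (ler_norm _))// normrN normrM.
apply: ler_wpM2l => //; apply: le_norm_dot; apply: sphere_bounded_by => //.
exact: sphere_pole.
Qed.

(** The constant [c] in place of [Cp kappa p.1] makes the density symmetric and bounded off the
    sphere too. *)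
Definition pair_density (p : V * V) : R :=
  (Zarea R n.+1)^-1 * (vmf_kernel p / c).

Lemma pair_densityE a b : sphere a -> sphere b ->
  pair_density (a, b) = p_x a * p_t_x kappa b a.
Proof.
move=> a1 b1; rewrite /pair_density /p_t_x /p_x vmf_kernelE//.
by rewrite (Cp_sphere kappa _ _ a1 sphere_pole).
Qed.

Lemma bounded_measurable_pair_density : bounded_measurable pair_density.
Proof.
apply: bounded_measurableM (bounded_measurable_cst _) _.
exact: bounded_measurableM bounded_measurable_vmf_kernel (bounded_measurable_cst _).
Qed.

Lemma pair_densityC a b : pair_density (a, b) = pair_density (b, a).
Proof. by rewrite /pair_density vmf_kernelC. Qed.

Lemma Sint_pair_density a : 0 < Zarea R n.+1 -> sphere a ->
  Sint (fun b => pair_density (a, b)) = (Zarea R n.+1)^-1.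
Proof.
move=> Z0 a1; have c0 := Cp_gt0 Z0.
rewrite (_ : (fun b => _) =
    fun b => ((Zarea R n.+1)^-1 / c) * vmf_kernel (a, b)); last first.
  by apply/funext => b; rewrite /pair_density; ring.
rewrite SintZ; last exact: bounded_measurable_section bounded_measurable_vmf_kernel.
by rewrite Sint_vmf_kernel// -mulrA mulVf ?mulr1// gt_eqF.
Qed.

End vmf.

Section latent_law.
Context {R : realType} {n : nat}.
Local Notation V := (n.+1.-tuple R).
Local Notation sigma := (@surface R n.+1).
Local Notation Z := (Zarea R n.+1).
Variable kappa : R.
Context {dO dMx dMt : measure_display} {Omega : measurableType dO}
  {Mx : measurableType dMx} {Mt : measurableType dMt}.
Variables (P : probability Omega R) (zx zt : nat -> Omega -> V)
  (mx : nat -> Omega -> Mx) (mt : nat -> Omega -> Mt).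
Hypothesis model : latent_model P kappa zx zt mx mt.

Let rho : V * V -> R := pair_density kappa.

(* If the area were 0 (or [+oo], of which [fine] is 0), then [p_x] would be
   [0^-1 = 0] and the model would give [P setT = 0]. *)
Lemma latent_area_gt0 : 0 < Z.
Proof.
rewrite lt0r; apply/andP; split; last by apply: fine_ge0; exact: measure_ge0.
apply/negP => /eqP Z0.
have [_ _ /(_ 0%N setT setT measurableT measurableT)] := model.
rewrite !preimage_setT setTI probability_setT; under eq_integral => a _.
  rewrite integral0_eq; last by move=> b _; rewrite /p_x Z0 invr0 mul0r.
  over.
by rewrite integral0 => /eqP; rewrite onee_eq0.
Qed.

Let Z0 := latent_area_gt0.

Lemma measurable_latent i :
  measurable_fun setT (zx i) /\ measurable_fun setT (zt i).
Proof.
have [[mW _ _] _ _] := model; have {}mW := mW i.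
have m1 := measurableT_comp measurable_fst (measurableT_comp measurable_fst mW).
by split; [exact: (measurableT_comp measurable_fst m1)|
  exact: (measurableT_comp measurable_snd m1)].
Qed.

Lemma latent_rectangle i (A B : set V) : measurable A -> measurable B ->
  P (zx i @^-1` A `&` zt i @^-1` B) =
  (Sint (fun a => Sint (fun b => \1_A a * (\1_B b * rho (a, b)))))%:E.
Proof.
move=> mA mB; have [_ _ ->//] := model.
have bB a : bounded_measurable (fun b => \1_B b * rho (a, b)).
  apply: bounded_measurableM; first exact: bounded_measurable_indic.
  exact: bounded_measurable_section (bounded_measurable_pair_density kappa).
have inner a : sphere a ->
    (\int[sigma]_(b in B `&` sphere) (p_x a * p_t_x kappa b a)%:E =
    (Sint (fun b => \1_B b * rho (a, b)))%:E)%E.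
  move=> a1; rewrite setIC integral_mkcondr -EFin_Sint//.
  apply: eq_integral => b /set_mem b1; rewrite patchE indicE.
  by rewrite -(pair_densityE kappa a1 b1); case: (b \in B); rewrite ?mul1r ?mul0r.
rewrite setIC integral_mkcondr -EFin_Sint; last first.
  rewrite (_ : (fun a => _) = fun a => \1_A a * Sint (fun b => \1_B b * rho (a, b))).
    apply: bounded_measurableM; first exact: bounded_measurable_indic.
    rewrite (_ : (fun a => _) = fun a =>
        Rintegral sigma setT (fun b => \1_B b * rho (a, b))).
      apply: (bounded_measurable_Rintegral_section
        (f := fun p : V * V => \1_B p.2 * rho p)).
      apply: bounded_measurableM (bounded_measurable_pair_density kappa).
      apply: (bounded_measurable_comp (W := snd)) => //.
      exact: bounded_measurable_indic.
    by apply/funext => a; rewrite SintT.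
  by apply/funext => a; rewrite SintZ.
apply: eq_integral => a /set_mem a1; rewrite patchE SintZ// indicE.
by case: (a \in A); rewrite ?mul1r ?mul0r// inner.
Qed.

Let zxt i w := (zx i w, zt i w).

Let mzxt i : measurable_fun setT (zxt i).
Proof. by have [mx1 mt1] := measurable_latent i; exact: measurable_fun_pair. Qed.

Let rho_ge0 p : 0 <= rho p.
Proof.
by rewrite /rho /pair_density mulr_ge0 ?invr_ge0 ?(ltW Z0)// divr_ge0 ?expR_ge0// ltW// Cp_gt0.
Qed.

Let mrho : measurable_fun setT rho.
Proof. exact: (bounded_measurable_pair_density kappa).1. Qed.

(** Both sides are measures of [C] that agree on rectangles, a generating class closed under
    intersection. *)
Lemma latent_pair_density i (C : set (V * V)) : measurable C ->
  P (zxt i @^-1` C) = (\int[sigma \x sigma]_(p in C) (rho p)%:E)%E.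
Proof.
pose G : set (set (V * V)) := [set A `*` B | A in measurable & B in measurable].
pose m1 := pushforward_measure P (zxt i) (mzxt i).
pose m2 := density_measure (sigma \x sigma)%E mrho rho_ge0.
apply: (@measure_unique _ _ _ G (fun=> setT) _ _ _ _ m1 m2).
- exact: measurable_prod_measurableType.
- move=> _ _ [A1 mA1 [B1 mB1 <-]] [A2 mA2 [B2 mB2 <-]]; rewrite -setXI.
  exists (A1 `&` A2); first exact: measurableI.
  by exists (B1 `&` B2) => //; exact: measurableI.
- by move=> _; exists setT => //; exists setT => //; rewrite setXTT.
- by rewrite bigcup_const//; exists 0%N.
- move=> _ [A mA [B mB <-]].
  rewrite /m1 /m2 /= /pushforward /density_measure.
  have -> : zxt i @^-1` (A `*` B) = zx i @^-1` A `&` zt i @^-1` B by [].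
  rewrite latent_rectangle// integral_mkcond.
  have bf : bounded_measurable (fun p : V * V => \1_A p.1 * (\1_B p.2 * rho p)).
    apply: bounded_measurableM.
      by apply: (bounded_measurable_comp (W := fst)) => //; exact: bounded_measurable_indic.
    apply: bounded_measurableM (bounded_measurable_pair_density kappa).
    by apply: (bounded_measurable_comp (W := snd)) => //; exact: bounded_measurable_indic.
  rewrite -(Sint_Sint bf) fineK; last first.
    apply: integrable_fin_num => //; exact: bounded_measurable_integrable_prod.
  apply: eq_integral => p _; rewrite patchE !indicE in_setX.
  by case: (p.1 \in A); case: (p.2 \in B); rewrite ?mul1r ?mul0r.
- by move=> k; rewrite /m1 /= /pushforward preimage_setT probability_setT ltry.
Qed.

Lemma latent_pair_expectation i (f : V * V -> R) : bounded_measurable f ->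
  Rintegral P setT (fun w => f (zx i w, zt i w)) =
  Sint (fun a => Sint (fun b => f (a, b) * rho (a, b))).
Proof.
move=> bf.
pose X : {mfun Omega >-> (V * V)%type} :=
  HB.pack (zxt i) (isMeasurableFun.Build _ _ _ _ _ (mzxt i)).
pose D : probability (V * V)%type R := distribution P X.
have bff : bounded_measurable (fun p => f p * rho p).
  exact: bounded_measurableM (bounded_measurable_pair_density kappa).
rewrite -(Sint_Sint bff) /Rintegral; congr fine.
transitivity (\int[D]_p (f p)%:E)%E.
  rewrite /D integral_distribution//; first by apply/measurable_EFinP; case: bf.
  apply: (@bounded_measurable_integrable _ _ _ P setT (f \o zxt i)) => //.
  exact: bounded_measurable_comp.
rewrite (@integral_density R _ (V * V)%type (@surface_product R n) D rho)//.
- by move=> A mA; rewrite -(latent_pair_density i).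
- exact: bounded_measurable_integrable.
Qed.

Lemma latent_expectation_x i (f : V -> R) : bounded_measurable f ->
  Rintegral P setT (fun w => f (zx i w)) = Z^-1 * Sint f.
Proof.
move=> bf; rewrite (@latent_pair_expectation i (fun p => f p.1)); last first.
  exact: (bounded_measurable_comp (W := fst)).
rewrite -SintZ//; apply: eq_Sint => a a1.
rewrite /= (@SintZ _ _ (f a) (fun b => rho (a, b))); last first.
  exact: bounded_measurable_section (bounded_measurable_pair_density kappa).
by rewrite Sint_pair_density// mulrC.
Qed.

Lemma latent_expectation_t i (f : V -> R) : bounded_measurable f ->
  Rintegral P setT (fun w => f (zt i w)) = Z^-1 * Sint f.
Proof.
move=> bf; have bf2 : bounded_measurable (fun p : V * V => f p.2).
  exact: (bounded_measurable_comp (W := snd)).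
rewrite (@latent_pair_expectation i (fun p => f p.2))//.
rewrite (@Sint_exchange _ _ (fun p => f p.2 * rho p)); last first.
  exact: bounded_measurableM (bounded_measurable_pair_density kappa).
rewrite -SintZ//; apply: eq_Sint => a a1 /=.
under [X in Sint X]eq_fun do rewrite /rho pair_densityC.
rewrite /= (@SintZ _ _ (f a) (fun b => rho (a, b))); last first.
  exact: bounded_measurable_section (bounded_measurable_pair_density kappa).
by rewrite Sint_pair_density// mulrC.
Qed.

(** Encoders and [h] are related only on the sphere. The law charges nothing else, both integrals of
    the model being restricted to it. *)
Lemma latent_sphere : {ae P, forall w i, sphere (zx i w) /\ sphere (zt i w)}.
Proof.
have mS := @measurable_sphere R n.+1.
have [_ _ H] := model.
suff Hi i : {ae P, forall w, sphere (zx i w) /\ sphere (zt i w)}.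
  by apply/ae_foralln.
have [mx1 mt1] := measurable_latent i.
have mC (z : Omega -> V) : measurable_fun setT z -> measurable (z @^-1` (~` sphere)).
  by move=> mz; rewrite -[X in measurable X]setTI; apply: mz => //; exact: measurableC.
have nx : P.-negligible (zx i @^-1` (~` sphere)).
  apply/negligibleP; first exact: mC.
  have := H i _ _ (measurableC mS) measurableT.
  by rewrite preimage_setT setIT setICl integral_set0.
have nt : P.-negligible (zt i @^-1` (~` sphere)).
  apply/negligibleP; first exact: mC.
  have := H i _ _ measurableT (measurableC mS).
  rewrite preimage_setT setTI setICl => E; apply: (eq_trans E).
  by apply: integral0_eq => a _; rewrite integral_set0.
apply: negligibleS (negligibleU nx nt) => w /= /not_andP[]; [by left|by right].
Qed.

End latent_law.

(** * The right-hand side *)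

Section contrastive_rhs.
Context {R : realType} {n : nat}.
Local Notation V := (n.+1.-tuple R).
Local Notation Z := (Zarea R n.+1).
Variables (kappa tau : R) (h : V -> V).
Hypotheses (h_meas : measurable_fun sphere h)
  (h_bdd : exists B, forall z, sphere z -> bounded_by B (h z)).
Hypothesis Z0 : 0 < Z.

Local Notation h' := (h \_ sphere).
Let rho : V * V -> R := pair_density kappa.

(** The limit of the inner averages, taken at an arbitrary vector [u] because grid points need not
    be values of [h]. *)
Definition mean_exp_dot (u : V) : R :=
  Z^-1 * Sint (fun b => expR (dot u (h' b) / tau)).

Lemma bounded_measurable_Sint_section (f : V * V -> R) : bounded_measurable f ->
  bounded_measurable (fun a => Sint (fun b => f (a, b))).
Proof.
move=> bf; rewrite (_ : (fun a => _) =
    fun a => Rintegral (@surface R n.+1) setT (fun b => f (a, b))).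
  exact: bounded_measurable_Rintegral_section.
by apply/funext => a; rewrite SintT//; exact: bounded_measurable_section.
Qed.

Lemma bounded_measurable_feature_dot :
  bounded_measurable (fun p : V * V => dot (h' p.1) (h' p.2)).
Proof.
have [mh [B hB]] := restrict_sphere_bounded h_meas h_bdd.
exact: bounded_measurable_dot mh hB.
Qed.

Lemma bounded_measurable_feature_kernel :
  bounded_measurable (fun p : V * V => expR (dot (h' p.1) (h' p.2) / tau)).
Proof.
apply: bounded_measurable_expR.
exact: bounded_measurableM bounded_measurable_feature_dot (bounded_measurable_cst _).
Qed.

Lemma bounded_measurable_exp_dot (u : V) :
  bounded_measurable (fun b => expR (dot u (h' b) / tau)).
Proof.
apply: bounded_measurable_expR.
apply: bounded_measurableM _ (bounded_measurable_cst _).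
have [mh [B hB]] := restrict_sphere_bounded h_meas h_bdd.
apply: bounded_measurable_sum => i.
apply: bounded_measurableM (bounded_measurable_cst _) _.
split; first by apply: (measurableT_comp (measurable_tnth i) mh).
by exists B => x; exact: hB.
Qed.

Lemma mean_exp_dot_feature a : sphere a ->
  mean_exp_dot (h' a) = Z^-1 * Cq_x tau h a.
Proof.
move=> a1; rewrite /mean_exp_dot /Cq_x; congr (_ * _).
by apply: eq_Sint => b b1; rewrite !restrict_sphereE.
Qed.

Lemma bounded_measurable_ln_mean :
  bounded_measurable (fun a => ln (mean_exp_dot (h' a))).
Proof.
have [_ [C kC]] := bounded_measurable_feature_dot.
apply: (@bounded_measurable_ln _ _ _ _ (expR (- (C * `|tau^-1|)))).
- exact: expR_gt0.
- move=> a; rewrite -ler_pdivrMl ?invr_gt0// invrK mulrC -Sint_cst.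
  apply: le_Sint; [exact: bounded_measurable_cst|exact: bounded_measurable_exp_dot|].
  move=> b _; rewrite ler_expR -lerN2 opprK (le_trans (ler_norm _))// normrN normrM.
  by apply: ler_wpM2r => //; exact: (kC (a, b)).
- apply: bounded_measurableM (bounded_measurable_cst _) _.
  exact: (bounded_measurable_Sint_section bounded_measurable_feature_kernel).
Qed.

Lemma mean_exp_dot_gt0 u : 0 < mean_exp_dot u.
Proof.
have [_ [C kC]] := bounded_measurable_exp_dot u.
have [mh [B hB]] := restrict_sphere_bounded h_meas h_bdd.
pose K := \sum_(i < n.+1) `|tnth u i|.
have uK : bounded_by K u.
  by move=> i; rewrite /K (bigD1 i)//= lerDl sumr_ge0.
rewrite /mean_exp_dot mulr_gt0 ?invr_gt0//.
apply: (@lt_le_trans _ _ (Sint (fun _ : V => expR (- (n.+1%:R * (K * B) * `|tau^-1|))))).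
  by rewrite Sint_cst mulr_gt0 ?expR_gt0.
apply: le_Sint; [exact: bounded_measurable_cst|exact: bounded_measurable_exp_dot|].
move=> b _; rewrite ler_expR -lerN2 opprK (le_trans (ler_norm _))// normrN normrM.
by apply: ler_wpM2r => //; exact: le_norm_dot.
Qed.

Lemma Cq_x_gt0 a : sphere a -> 0 < Cq_x tau h a.
Proof.
move=> a1; have := mean_exp_dot_gt0 (h' a); rewrite mean_exp_dot_feature//.
by rewrite pmulr_rgt0 ?invr_gt0.
Qed.

(** The logarithm of [q_t_x] is the exponent minus the log-normaliser, which does not depend on [b]
    and is therefore weighted by the total mass of the conditional law. *)
Lemma px_cross_entropy a : sphere a ->
  p_x a * cross_entropy (p_t_x kappa ^~ a) (q_t_x tau h ^~ a) =
  - tau^-1 * Sint (fun b => dot (h' a) (h' b) * rho (a, b)) +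
    Z^-1 * ln (Cq_x tau h a).
Proof.
move=> a1; have Z00 : Z != 0 by rewrite gt_eqF.
have bd : bounded_measurable (fun b => dot (h' a) (h' b) * rho (a, b)).
  apply: (@bounded_measurable_section _ _ (fun p => dot (h' p.1) (h' p.2) * rho p)).
  exact: bounded_measurableM bounded_measurable_feature_dot
    (bounded_measurable_pair_density kappa).
have br : bounded_measurable (fun b => rho (a, b)).
  exact: bounded_measurable_section (bounded_measurable_pair_density kappa).
rewrite /cross_entropy (@eq_Sint _ _ _ (fun b =>
    (Z / tau) * (dot (h' a) (h' b) * rho (a, b)) +
    - (Z * ln (Cq_x tau h a)) * rho (a, b))); last first.
  move=> b b1; rewrite /q_t_x ln_div ?posrE ?expR_gt0 ?Cq_x_gt0// expRK.
  rewrite /rho pair_densityE// /p_x !restrict_sphereE// dotC.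
  move: (tau^-1) (p_t_x _ _ _) (dot _ _) (ln _) => t p D l.
  by field.
rewrite SintD; last 2 first.
- exact: bounded_measurableM (bounded_measurable_cst _) bd.
- exact: bounded_measurableM (bounded_measurable_cst _) br.
rewrite SintZ// SintZ// Sint_pair_density// /p_x.
set S := Sint _; move: (tau^-1) (ln _) => t l.
by field.
Qed.

Lemma p_t_sphere (t : V) : sphere t -> p_t kappa t = Z^-1.
Proof.
move=> t1; rewrite -(Sint_pair_density kappa Z0 t1) /p_t.
by apply: eq_Sint => z z1; rewrite pair_densityC pair_densityE.
Qed.

(** The two uniform marginals cancel in Bayes' rule, leaving the symmetric joint density. *)
Lemma p_x_t_sphere (z t : V) : sphere z -> sphere t ->
  p_x_t kappa z t = p_t_x kappa z t.
Proof.
move=> z1 t1; rewrite /p_x_t p_t_sphere// -pair_densityE//.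
by rewrite pair_densityC pair_densityE// /p_x invrK mulrAC mulVf ?mul1r// gt_eqF.
Qed.

Lemma rhsE : rhs kappa tau h =
  2 * (- tau^-1 * Sint (fun a => Sint (fun b => dot (h' a) (h' b) * rho (a, b))) +
       Z^-1 * Sint (fun a => ln (mean_exp_dot (h' a))) + ln Z).
Proof.
have Z00 : Z != 0 by rewrite gt_eqF.
have bS : bounded_measurable (fun a => Sint (fun b => dot (h' a) (h' b) * rho (a, b))).
  apply: (bounded_measurable_Sint_section (f := fun p => dot (h' p.1) (h' p.2) * rho p)).
  exact: bounded_measurableM bounded_measurable_feature_dot
    (bounded_measurable_pair_density kappa).
pose S1 := Sint (fun a => p_x a *
      cross_entropy (p_t_x kappa ^~ a) (q_t_x tau h ^~ a)).
have S1E : S1 =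
    - tau^-1 * Sint (fun a => Sint (fun b => dot (h' a) (h' b) * rho (a, b))) +
       Z^-1 * Sint (fun a => ln (mean_exp_dot (h' a))) + ln Z.
  rewrite /S1 (@eq_Sint _ _ _ (fun a =>
    (- tau^-1 * Sint (fun b => dot (h' a) (h' b) * rho (a, b)) +
     Z^-1 * ln (mean_exp_dot (h' a))) + Z^-1 * ln Z)); last first.
    move=> a a1; rewrite px_cross_entropy// mean_exp_dot_feature//.
    (* [mean_exp_dot] is [Cq_x] divided by the area. This produces [ln Z], which appears twice in
       the final limit. *)
    rewrite lnM ?posrE ?invr_gt0 ?Cq_x_gt0// lnV ?posrE//.
    by rewrite -addrA -mulrDr addrC addrAC addNr add0r addrC.
  have b1 : bounded_measurable (fun a =>
      - tau^-1 * Sint (fun b => dot (h' a) (h' b) * rho (a, b))).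
    exact: bounded_measurableM (bounded_measurable_cst _) bS.
  have b2 : bounded_measurable (fun a => Z^-1 * ln (mean_exp_dot (h' a))).
    exact: bounded_measurableM (bounded_measurable_cst _) bounded_measurable_ln_mean.
  rewrite SintD; [|exact: bounded_measurableD|exact: bounded_measurable_cst].
  rewrite SintD// SintZ// SintZ; last exact: bounded_measurable_ln_mean.
  by rewrite Sint_cst mulrAC mulVf// mul1r.
have S2E : Sint (fun zt => p_t kappa zt *
    cross_entropy (p_x_t kappa ^~ zt) (q_x_t tau h ^~ zt)) = S1.
  apply: eq_Sint => t t1; rewrite (p_t_sphere t1).
  apply: (congr1 (fun x => Z^-1 * - x)); apply: eq_Sint => z z1.
  rewrite (p_x_t_sphere z1 t1).
  have -> : q_x_t tau h z t = q_t_x tau h z t.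
    rewrite /q_x_t /q_t_x; apply: (congr1 (fun x => _ / x)).
    by apply: eq_Sint => a a1; rewrite dotC.
  by [].
have dbl (x : R) : x + x = 2 * x by ring.
exact: eq_trans (congr2 +%R (erefl S1) S2E) (eq_trans (dbl S1) (congr1 _ S1E)).
Qed.

End contrastive_rhs.

(** * Uniform law of large numbers and the limit of the loss *)

(** Finite intersections stay in a filter; this serves both [\oo] and the almost-everywhere
    filter. *)
Lemma near_all_seq {T : Type} {E : eqType} (F : set_system T) (FF : Filter F)
    (s : seq E) (Q : E -> T -> Prop) :
  (forall u, u \in s -> \forall x \near F, Q u x) ->
  \forall x \near F, forall u, u \in s -> Q u x.
Proof.
elim: s => [_|u s IH H]; first by near=> x.
have H1 := H u (mem_head _ _).
have /IH H2 v : v \in s -> \forall x \near F, Q v x.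
  by move=> vs; apply: H; rewrite in_cons vs orbT.
near=> x => v; rewrite in_cons => /predU1P[->|]; first by near: x.
by move: v; near: x.
Unshelve. all: by end_near. Qed.

Section uniform_law.
Context {R : realType} {n : nat}.
Local Notation V := (n.+1.-tuple R).
Variables (tau B : R).
Hypothesis tau0 : 0 < tau.

(** Mesh [1 / m.+1] in the cube of half-width [B]; coordinates are rounded down, hence the largest
    index is the integer part of [2 * B * m.+1]. *)
Definition grid (m : nat) : seq V :=
  [seq [tuple - B + (g i)%:R / m.+1%:R | i < n.+1] |
    g : {ffun 'I_n.+1 -> 'I_(Num.truncn (2 * B * m.+1%:R)).+1}].

Lemma grid_close m (u : V) : bounded_by B u ->
  exists2 u', u' \in grid m & forall i, `|tnth u i - tnth u' i| <= m.+1%:R^-1.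
Proof.
move=> uB; have m0 : 0 < m.+1%:R :> R by rewrite ltr0n.
pose g : {ffun 'I_n.+1 -> 'I_(Num.truncn (2 * B * m.+1%:R)).+1} :=
  [ffun i => inord (Num.truncn ((tnth u i + B) * m.+1%:R))].
exists [tuple - B + (g i)%:R / m.+1%:R | i < n.+1].
  by rewrite /grid; apply/mapP; exists g; rewrite ?mem_enum.
move=> i; rewrite tnth_mktuple ffunE.
have /andP[lu ub] : - B <= tnth u i <= B by rewrite -ler_norml.
have x0 : 0 <= (tnth u i + B) * m.+1%:R by rewrite mulr_ge0//; lra.
rewrite inordK; last first.
  by rewrite ltnS le_truncn// ler_wpM2r//; lra.
have : (Num.truncn ((tnth u i + B) * m.+1%:R))%:R <= (tnth u i + B) * m.+1%:R.
  by rewrite truncn_le.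
have : (tnth u i + B) * m.+1%:R < (Num.truncn ((tnth u i + B) * m.+1%:R))%:R + 1.
  by rewrite natr1 truncnS_gt.
set k : R := (Num.truncn _)%:R => h1 h2.
have {}h1 : tnth u i + B < k / m.+1%:R + m.+1%:R^-1.
  have -> : k / m.+1%:R + m.+1%:R^-1 = (k + 1) / m.+1%:R by rewrite mulrDl mul1r.
  by rewrite ltr_pdivlMr.
have {}h2 : k / m.+1%:R <= tnth u i + B by rewrite ler_pdivrMr.
have m1 : 0 <= m.+1%:R^-1 :> R by rewrite invr_ge0 ltW.
rewrite ler_norml; move: h1 h2 m1; rewrite -/k.
move: (k / m.+1%:R : R) (m.+1%:R^-1 : R) (tnth u i : R) => q r x h1 h2 r0.
by apply/andP; split; lra.
Qed.

(** The comparison is by a factor because factors pass through averages and integrals unchanged, and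
    the logarithm turns them into additive errors independent of [N]. *)
Lemma exp_dot_close (e : R) (u u' v : V) :
  (forall i, `|tnth u i - tnth u' i| <= e) -> bounded_by B v ->
  expR (dot u v / tau) <= expR (n.+1%:R * (e * B) / tau) * expR (dot u' v / tau).
Proof.
move=> uu' vB; rewrite -expRD ler_expR -mulrDl ler_pM2r ?invr_gt0//.
rewrite -lerBlDr -dotB; apply: le_trans (ler_norm _) _; apply: le_norm_dot => //.
by move=> i; rewrite tnth_translate tnth_mktuple.
Qed.

Variables (v : nat -> V) (F : V -> R).
Hypothesis vB : forall j, bounded_by B (v j).
Hypothesis F0 : forall u, 0 < F u.
Hypothesis F_close : forall e u u', (forall i, `|tnth u i - tnth u' i| <= e) ->
  F u <= expR (n.+1%:R * (e * B) / tau) * F u'.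

Let A (N : nat) (u : V) := N%:R^-1 * \sum_(j < N) expR (dot u (v j) / tau).

Hypothesis grid_law : forall m u, u \in grid m -> A ^~ u @ \oo --> F u.

Let A_gt0 N u : (0 < N)%N -> 0 < A N u.
Proof.
case: N => // N _; rewrite /A mulr_gt0 ?invr_gt0 ?ltr0n//.
by rewrite big_ord_recl ltr_pwDl ?expR_gt0// sumr_ge0// => *; rewrite expR_ge0.
Qed.

Let A_close N e u u' : (forall i, `|tnth u i - tnth u' i| <= e) ->
  A N u <= expR (n.+1%:R * (e * B) / tau) * A N u'.
Proof.
move=> uu'; rewrite /A mulrCA ler_wpM2l ?invr_ge0// mulr_sumr.
by apply: ler_sum => j _; exact: exp_dot_close.
Qed.

Let ln_close (x y e : R) : 0 < x -> 0 < y -> x <= expR e * y -> ln x <= e + ln y.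
Proof.
move=> x0 y0 xy; rewrite -[e in leRHS]expRK -lnM ?posrE ?expR_gt0//.
by rewrite ler_ln ?posrE ?mulr_gt0 ?expR_gt0.
Qed.

(** Deterministic: [v] stands for one realisation on which the law holds at all grid points. A
    vector is moved to a nearby grid point in both [A] and [F]. *)
Lemma uniform_ln_law e : 0 < e -> \forall N \near \oo,
  forall u, bounded_by B u -> `|ln (A N u) - ln (F u)| <= e.
Proof.
move=> e0.
(* Moving to the grid costs [dlt] twice; with [dlt <= e / 4] this leaves [e / 2] for the error on
   the grid. *)
pose m := Num.truncn (4 * (n.+1%:R * B / tau) / e).
pose dlt := n.+1%:R * (m.+1%:R^-1 * B) / tau.
have dlt_e : dlt <= e / 4.
  have h : 4 * (n.+1%:R * B / tau) / e <= m.+1%:R by exact/ltW/truncnS_gt.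
  have m0 : 0 < m.+1%:R :> R by rewrite ltr0n.
  rewrite ler_pdivrMr// in h.
  have -> : dlt = (n.+1%:R * B / tau) / m.+1%:R by rewrite /dlt; ring.
  by rewrite ler_pdivrMr//; nra.
have near_grid : \forall N \near \oo, forall u, u \in grid m ->
    `|ln (A N u) - ln (F u)| <= e / 2.
  apply: near_all_seq => u um.
  have : (fun N => ln (A N u)) @ \oo --> ln (F u).
    apply: (continuous_cvg _ _ (grid_law um)); exact: continuous_ln.
  move=> /cvgrPdist_le /(_ (e / 2)); rewrite divr_gt0// => /(_ isT).
  by apply: filterS => N; rewrite distrC.
near=> N => u uB.
have N0 : (0 < N)%N by near: N; exists 1%N.
have [u' um uu'] := grid_close m uB.
have u'u i : `|tnth u' i - tnth u i| <= m.+1%:R^-1 by rewrite distrC.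
have hN : `|ln (A N u') - ln (F u')| <= e / 2.
  by move: (u') um; near: N.
have h1 := ln_close (A_gt0 u N0) (A_gt0 u' N0) (A_close N uu').
have h2 := ln_close (A_gt0 u' N0) (A_gt0 u N0) (A_close N u'u).
have h3 := ln_close (F0 u) (F0 u') (F_close uu').
have h4 := ln_close (F0 u') (F0 u) (F_close u'u).
move: hN; rewrite -/dlt in h1 h2 h3 h4; rewrite !ler_norml => /andP[h5 h6].
by apply/andP; split; lra.
Unshelve. all: by end_near. Qed.

(** Uniformity allows the outer points [u i] to depend on the inner sample [v], as they do in the
    loss. *)
Lemma average_ln_average (u : nat -> V) (L : R) :
  (forall i, bounded_by B (u i)) ->
  (fun N => N%:R^-1 * \sum_(i < N) ln (F (u i))) @ \oo --> L ->
  (fun N => N%:R^-1 * \sum_(i < N) ln (A N (u i))) @ \oo --> L.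
Proof.
move=> uB /cvgrPdist_le FL; apply/cvgrPdist_le => e e0.
have e20 : 0 < e / 2 by rewrite divr_gt0.
have U := uniform_ln_law e20.
near=> N.
have N0 : (0 < N)%N by near: N; exists 1%N.
have hF : `|L - N%:R^-1 * \sum_(i < N) ln (F (u i))| <= e / 2.
  by near: N; exact: FL.
have hU : forall u, bounded_by B u -> `|ln (A N u) - ln (F u)| <= e / 2.
  by near: N.
have N0' : 0 < N%:R :> R by rewrite ltr0n.
have hA : `|N%:R^-1 * \sum_(i < N) ln (F (u i)) -
    N%:R^-1 * \sum_(i < N) ln (A N (u i))| <= e / 2.
  rewrite -mulrBr -sumrB normrM normfV (gtr0_norm N0') ler_pdivrMl//.
  apply: le_trans (ler_norm_sum _ _ _) _.
  apply: (@le_trans _ _ (\sum_(i < N) e / 2)).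
    by apply: ler_sum => i _; rewrite distrC; exact: hU.
  by rewrite sumr_const card_ord mulr_natl.
rewrite [e in leRHS](splitr e) -[X in `|X|](subrKA (N%:R^-1 * \sum_(i < N) ln (F (u i)))).
by apply: le_trans (ler_normD _ _) _; exact: lerD.
Unshelve. all: by end_near. Qed.

End uniform_law.

Lemma mean_exp_dot_close {R : realType} {n : nat} (tau B e : R)
    (h : n.+1.-tuple R -> n.+1.-tuple R) (u u' : n.+1.-tuple R) :
  0 < tau -> 0 < Zarea R n.+1 -> measurable_fun sphere h ->
  (exists B, forall z, sphere z -> bounded_by B (h z)) ->
  (forall z, bounded_by B ((h \_ sphere) z)) ->
  (forall i, `|tnth u i - tnth u' i| <= e) ->
  mean_exp_dot tau h u <= expR (n.+1%:R * (e * B) / tau) * mean_exp_dot tau h u'.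
Proof.
move=> tau0 Z0 mh bh hB uu'; rewrite /mean_exp_dot [leRHS]mulrCA.
rewrite ler_wpM2l ?invr_ge0 ?(ltW Z0)//.
rewrite -SintZ; last exact: bounded_measurable_exp_dot.
apply: le_Sint; first exact: bounded_measurable_exp_dot.
  apply: bounded_measurableM (bounded_measurable_cst _) _.
  exact: bounded_measurable_exp_dot.
by move=> b _; exact: exp_dot_close.
Qed.

Section loss.
Context {R : realType} {M : nat}.
Local Notation V := (M.-tuple R).

(** Turning a denominator into an average costs [ln N], once per direction: hence the [2 log N].
    Symmetry of [dot] gives both directions the same shape. *)
Lemma contrastive_lossE (tau : R) (N : nat) (u v : nat -> V) : (0 < N)%N ->
  contrastive_loss (fun a b => - dot a b) tau N u v - 2 * ln N%:R =
  (- 2 / tau) * (N%:R^-1 * \sum_(i < N) dot (u i) (v i)) +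
  N%:R^-1 * (\sum_(i < N) ln (N%:R^-1 * \sum_(j < N) expR (dot (u i) (v j) / tau))) +
  N%:R^-1 * (\sum_(i < N) ln (N%:R^-1 * \sum_(j < N) expR (dot (v i) (u j) / tau))).
Proof.
move=> N0; have N0' : N%:R != 0 :> R by rewrite pnatr_eq0 -lt0n.
have Np : 0 < N%:R :> R by rewrite ltr0n.
have lnE (x : R) (s : nat -> R) : (forall j, 0 < s j) ->
    ln (expR x / \sum_(j < N) s j) =
    x - ln N%:R - ln (N%:R^-1 * \sum_(j < N) s j).
  move=> s0; have S0 : 0 < \sum_(j < N) s j.
    case: N N0 {N0' Np} => // N _; rewrite big_ord_recl ltr_pwDl//.
    by rewrite sumr_ge0// => *; rewrite ltW.
  rewrite ln_div ?posrE ?expR_gt0// expRK lnM ?posrE ?invr_gt0// lnV ?posrE//.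
  by ring.
rewrite /contrastive_loss.
rewrite (eq_bigr (fun i : 'I_N => dot (u i) (v i) / tau - ln N%:R -
    ln (N%:R^-1 * \sum_(j < N) expR (dot (u i) (v j) / tau)))); last first.
  move=> i _; rewrite opprK (lnE _ (fun j => expR (- - dot (u i) (v j) / tau))).
    by do 2 f_equal; under eq_bigr do rewrite opprK.
  by move=> j; exact: expR_gt0.
rewrite [X in _ - _ * X - _](eq_bigr (fun i : 'I_N => dot (u i) (v i) / tau - ln N%:R -
    ln (N%:R^-1 * \sum_(j < N) expR (dot (v i) (u j) / tau)))); last first.
  move=> i _; rewrite opprK (lnE _ (fun j => expR (- - dot (u j) (v i) / tau))).
    by do 2 f_equal; under eq_bigr do rewrite opprK dotC.
  by move=> j; exact: expR_gt0.
rewrite !sumrB -mulr_suml sumr_const card_ord -[ln _ *+ N]mulr_natl.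
set D := \sum_(i < N) dot _ _; set A := \sum_(i < N) ln _; set C := \sum_(i < N) ln _.
move: (tau^-1) (ln N%:R) => t l.
by field.
Qed.

End loss.

Lemma contrastive_limit {R : realType} {n : nat} (kappa tau : R)
    {dO dMx dMt : measure_display} {Omega : measurableType dO}
    {Mx : measurableType dMx} {Mt : measurableType dMt}
    (h : n.+1.-tuple R -> n.+1.-tuple R)
    (P : probability Omega R) (zx zt : nat -> Omega -> n.+1.-tuple R)
    (mx : nat -> Omega -> Mx) (mt : nat -> Omega -> Mt) :
  0 < tau -> measurable_fun sphere h ->
  (exists B, forall z, sphere z -> bounded_by B (h z)) ->
  latent_model P kappa zx zt mx mt ->
  {ae P, forall w, (fun N : nat =>
      contrastive_loss (fun a b => - dot a b) tau N
        (fun i => (h \_ sphere) (zx i w)) (fun i => (h \_ sphere) (zt i w))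
      - 2 * ln N%:R)
    @ \oo --> rhs kappa tau h - 2 * ln (Zarea R n.+1)}.
Proof.
move=> tau0 mh bh model; have Z0 := latent_area_gt0 model.
have [iidW _ _] := model.
have [mh' [B hB]] := restrict_sphere_bounded mh bh.
set Z := Zarea R n.+1 in Z0 *; pose h' := h \_ sphere.
pose F := mean_exp_dot tau h.
have lawx (f : n.+1.-tuple R -> R) : bounded_measurable f ->
    {ae P, forall w, (fun N => N%:R^-1 * \sum_(i < N) f (zx i w)) @ \oo -->
      Z^-1 * Sint f}.
  move=> bf; rewrite -(latent_expectation_x model 0 bf).
  apply: (strong_law_bounded iidW (f := fun p => f p.1.1.1)).
  apply: (bounded_measurable_comp (W := fst) (f := fun p => f p.1.1)) => //.
  apply: (bounded_measurable_comp (W := fst) (f := fun p => f p.1)) => //.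
  exact: (bounded_measurable_comp (W := fst)).
have lawt (f : n.+1.-tuple R -> R) : bounded_measurable f ->
    {ae P, forall w, (fun N => N%:R^-1 * \sum_(i < N) f (zt i w)) @ \oo -->
      Z^-1 * Sint f}.
  move=> bf; rewrite -(latent_expectation_t model 0 bf).
  apply: (strong_law_bounded iidW (f := fun p => f p.1.1.2)).
  apply: (bounded_measurable_comp (W := fst) (f := fun p => f p.1.2)) => //.
  apply: (bounded_measurable_comp (W := fst) (f := fun p => f p.2)) => //.
  exact: (bounded_measurable_comp (W := snd)).
have bdot := bounded_measurable_feature_dot mh bh.
have lawd : {ae P, forall w,
    (fun N => N%:R^-1 * \sum_(i < N) dot (h' (zx i w)) (h' (zt i w))) @ \oo -->
    Sint (fun a => Sint (fun b => dot (h' a) (h' b) * pair_density kappa (a, b)))}.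
  rewrite -(latent_pair_expectation model 0 bdot).
  apply: (strong_law_bounded iidW (f := fun p => dot (h' p.1.1.1) (h' p.1.1.2))).
  apply: (bounded_measurable_comp (W := fst)
    (f := fun p => dot (h' p.1.1) (h' p.1.2))) => //.
  exact: (bounded_measurable_comp (W := fst) (f := fun p => dot (h' p.1) (h' p.2))).
have bln : bounded_measurable (fun a => ln (F (h' a))).
  exact: bounded_measurable_ln_mean.
have lawlx := lawx _ bln; have lawlt := lawt _ bln.
(* Each grid is finite and [m] ranges over [nat], so only countably many null sets are discarded. *)
have gridx : {ae P, forall w m (u : n.+1.-tuple R), u \in grid B m ->
    (fun N => N%:R^-1 * \sum_(j < N) expR (dot u (h' (zx j w)) / tau)) @ \oo --> F u}.
  apply/ae_foralln => m; apply: near_all_seq => u _.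
  by apply: lawx; exact: bounded_measurable_exp_dot.
have gridt : {ae P, forall w m (u : n.+1.-tuple R), u \in grid B m ->
    (fun N => N%:R^-1 * \sum_(j < N) expR (dot u (h' (zt j w)) / tau)) @ \oo --> F u}.
  apply/ae_foralln => m; apply: near_all_seq => u _.
  by apply: lawt; exact: bounded_measurable_exp_dot.
apply: filterS2 (filterI lawlx gridt) (filterI lawd (filterI lawlt gridx)).
move=> w [lx gt] [ld [lt gx]].
have F0 u : 0 < F u by exact: mean_exp_dot_gt0.
have F_close e u u' : (forall i, `|tnth u i - tnth u' i| <= e) ->
  F u <= expR (n.+1%:R * (e * B) / tau) * F u'.
  exact: mean_exp_dot_close.
(* Inner averages over [zt] meet outer ones over [zx], then conversely; both limits are [L] since
   both marginals are uniform. *)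
have cx := average_ln_average tau0 (fun j => hB (zt j w)) F0 F_close (gt : forall m u, _ -> _)
  (fun i => hB (zx i w)) lx.
have ct := average_ln_average tau0 (fun j => hB (zx j w)) F0 F_close (gx : forall m u, _ -> _)
  (fun i => hB (zt i w)) lt.
set D := Sint _ in ld; set L := Z^-1 * _ in cx ct.
have -> : rhs kappa tau h - 2 * ln Z = (- 2 / tau) * D + L + L.
  by rewrite (rhsE kappa tau mh bh Z0) -/D -/L; move: (tau^-1) => t; ring.
apply: (cvg_trans _ (cvgD (cvgD (cvgM (cvg_cst (- 2 / tau)) ld) cx) ct)).
apply: near_eq_cvg; near=> N.
by rewrite contrastive_lossE//; near: N; exists 1%N.
Unshelve. all: by end_near. Qed.

Theorem theorem4p1
  (R : realType) (M : nat) (hM : (0 < M)%N)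
  (kappa tau : R) (hkappa : 0 < kappa) (htau : 0 < tau)
  (dMx dMt dO : measure_display)
  (Mx : measurableType dMx) (Mt : measurableType dMt)
  (X T : Type)
  (gx : M.-tuple R -> Mx -> X) (gt : M.-tuple R -> Mt -> T)
  (gx_inj : forall z1 z2 m1 m2, sphere z1 -> sphere z2 ->
              gx z1 m1 = gx z2 m2 -> z1 = z2 /\ m1 = m2)
  (gt_inj : forall z1 z2 m1 m2, sphere z1 -> sphere z2 ->
              gt z1 m1 = gt z2 m2 -> z1 = z2 /\ m1 = m2)
  (fx : X -> M.-tuple R) (ft : T -> M.-tuple R)
  (h : M.-tuple R -> M.-tuple R)
  (h_meas : measurable_fun sphere h)
  (h_bdd : exists B : R, forall z, sphere z -> forall i, `|tnth (h z) i| <= B)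
  (hfx : forall z m, sphere z -> fx (gx z m) = h z)
  (hft : forall z m, sphere z -> ft (gt z m) = h z)
  (Omega : measurableType dO) (P : probability Omega R)
  (zx zt : nat -> Omega -> M.-tuple R) (mx : nat -> Omega -> Mx) (mt : nat -> Omega -> Mt)
  (Hmodel : latent_model P kappa zx zt mx mt) :
  {ae P, forall w,
    (fun N : nat =>
       contrastive_loss (fun a b => - dot a b) tau N
         (fun i => fx (gx (zx i w) (mx i w)))
         (fun i => ft (gt (zt i w) (mt i w)))
       - 2 * ln N%:R)
    @ \oo --> rhs kappa tau h - 2 * ln (Zarea R M)}.
Proof.
case: M hM gx gt gx_inj gt_inj fx ft h h_meas h_bdd hfx hft zx zt Hmodel => // n _.
move=> gx gt _ _ fx ft h h_meas h_bdd hfx hft zx zt Hmodel.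
have := contrastive_limit htau h_meas h_bdd Hmodel.
apply: filterS2 (latent_sphere Hmodel) => w zS.
have -> : (fun i => fx (gx (zx i w) (mx i w))) = (fun i => (h \_ sphere) (zx i w)).
  by apply/funext => i; have [z1 _] := zS i; rewrite hfx// restrict_sphereE.
have -> : (fun i => ft (gt (zt i w) (mt i w))) = (fun i => (h \_ sphere) (zt i w)).
  by apply/funext => i; have [_ z1] := zS i; rewrite hft// restrict_sphereE.
exact.
Qed.
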